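(* If $\Lambda_X(\mathcal{A})$ is empty, then $C_X(\mathcal{A})=\mathbb{R}^{\mathcal{A}}_+$. Otherwise, \[C_X(\mathcal{A})=\operatorname{cl}\Big(\operatorname{conv}\bigcup_{\lambda\in\Lambda_X^\star(\mathcal{A})}C_X(\mathcal{A},\lambda)\Big).\]
   Context: $X\subset\mathbb{R}^n$ is a nonempty closed convex set and $\mathcal{A}\subset\mathbb{R}^n$ is a nonempty finite set such that the functions $x\mapsto\exp(\alpha^Tx)$, $\alpha\in\mathcal{A}$, are linearly independent on $X$. $\mathbb{R}^{\mathcal{A}}$ denotes real vectors indexed by $\mathcal{A}$. $\mathcal{A}\nu=\sum_\alpha\alpha\nu_\alpha$. $\sigma_X(y)=\sup\{y^Tx:x\in X\}$. $N_\beta=\{\nu\in\mathbb{R}^{\mathcal{A}}:\nu_\alpha\ge0\ \forall\alpha\neq\beta,\ \sum_\alpha\nu_\alpha=0\}$. A vector $\nu^\star\in N_\beta$ is an $X$-circuit of $\mathcal{A}$ if (1) $\nu^\star\neq0$, (2) $\sigma_X(-\mathcal{A}\nu^\star)<\infty$, and (3) $\nu^\star$ cannot be written as a convex combination of two non-proportional vectors $\nu^{(1)},\nu^{(2)}\in N_\beta$ such that the map $\nu\mapsto\sigma_X(-\mathcal{A}\nu)$ is affine on the segment $[\nu^{(1)},\nu^{(2)}]$. $\Lambda_X(\mathcal{A})$ is the set of all $X$-circuits $\lambda$ (over all $\beta\in\mathcal{A}$) normalized so that the unique negative entry equals $-1$. The functional form of $\lambda\in\Lambda_X(\mathcal{A})$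 is $\phi_\lambda=(\lambda,\sigma_X(-\mathcal{A}\lambda))\in\mathbb{R}^{\mathcal{A}}\times\mathbb{R}$. The circuit graph is $G_X(\mathcal{A})=\operatorname{cone}(\{\phi_\lambda:\lambda\in\Lambda_X(\mathcal{A})\}\cup\{(0,1)\})$. The set of normalized reduced $X$-circuits $\Lambda_X^\star(\mathcal{A})$ consists of those $\lambda\in\Lambda_X(\mathcal{A})$ for which $\{t\phi_\lambda:t\ge0\}$ is an extreme ray of $G_X(\mathcal{A})$. Signomials $f=\sum_\alpha c_\alpha\mathrm{e}^\alpha$, $\mathrm{e}^\alpha(x)=\exp(\alpha^Tx)$, are identified with $c\in\mathbb{R}^{\mathcal{A}}$; $C_X(\mathcal{A},\beta)$ is the set of $c$ with $f$ nonnegative on $X$ and $c_\alpha\ge0$ for $\alpha\ne\beta$, and $C_X(\mathcal{A})=\sum_{\beta\in\mathcal{A}}C_X(\mathcal{A},\beta)$. For $\lambda\in\Lambda_X(\mathcal{A})$ with negative index $\beta$ and $\lambda^+=\{\alpha:\lambda_\alpha>0\}$, the $\lambda$-witnessed AGE cone is $C_X(\mathcal{A},\lambda)=\{c: c_\alpha\ge0\ \forall\alpha\neq\beta,\ \prod_{\alpha\in\lambda^+}(c_\alpha/\lambda_\alpha)^{\lambda_\alpha}\ge -c_\beta\exp(\sigma_X(-\mathcal{A}\lambda))\}$. *)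

(* Defs.v *)
From HB Require Import structures.
From mathcomp Require Import all_boot all_order all_algebra.
From mathcomp Require Import all_classical all_reals all_analysis.
Set Implicit Arguments. Unset Strict Implicit. Unset Printing Implicit Defensive.
Import Order.TTheory GRing.Theory Num.Theory.
Import numFieldNormedType.Exports.
Local Open Scope ring_scope.
Local Open Scope classical_set_scope.

(* Conventions.  Points of R^n are row vectors 'rV[R]_n.  The finite set
   A = {alpha_0, ..., alpha_{m-1}} of exponent vectors is given by an
   indexing map alpha : 'I_m -> 'rV[R]_n, so R^A is 'rV[R]_m (coordinate
   i of c : 'rV[R]_m is c 0 i, the coefficient of e^{alpha i}). *)

Section Defs.
Variables (R : realType) (n m : nat).

Definition dotp (y x : 'rV[R]_n) : R := \sum_(i < n) y 0 i * x 0 i.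

Definition Amul (alpha : 'I_m -> 'rV[R]_n) (nu : 'rV[R]_m) : 'rV[R]_n :=
  \sum_(i < m) nu 0 i *: alpha i.

Definition sigmaX (X : set 'rV[R]_n) (y : 'rV[R]_n) : \bar R :=
  ereal_sup [set (dotp y x)%:E | x in X].

Definition convex_setR (X : set 'rV[R]_n) : Prop :=
  forall x y t, X x -> X y -> 0 <= t <= 1 -> X (t *: x + (1 - t) *: y).

Definition exp_lin_indep (X : set 'rV[R]_n) (alpha : 'I_m -> 'rV[R]_n) : Prop :=
  forall c : 'rV[R]_m,
    (forall x, X x -> \sum_(i < m) c 0 i * expR (dotp (alpha i) x) = 0) ->
    c = 0.

Definition Nbeta (beta : 'I_m) : set 'rV[R]_m :=
  [set nu : 'rV[R]_m | (forall i, i != beta -> 0 <= nu 0 i) /\ \sum_(i < m) nu 0 i = 0].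

Definition proportional (u v : 'rV[R]_m) : Prop :=
  (exists c : R, u = c *: v) \/ (exists c : R, v = c *: u).

Definition sigma_affine_on_segment (X : set 'rV[R]_n) (alpha : 'I_m -> 'rV[R]_n)
    (nu1 nu2 : 'rV[R]_m) : Prop :=
  forall s : R, 0 <= s <= 1 ->
    sigmaX X (- Amul alpha (s *: nu1 + (1 - s) *: nu2)) =
    (s%:E * sigmaX X (- Amul alpha nu1) + (1 - s)%:E * sigmaX X (- Amul alpha nu2))%E.

Definition Xcircuit (X : set 'rV[R]_n) (alpha : 'I_m -> 'rV[R]_n) (beta : 'I_m)
    (nu : 'rV[R]_m) : Prop :=
  [/\ Nbeta beta nu,
      nu != 0,
      (sigmaX X (- Amul alpha nu) < +oo)%E &
      ~ (exists nu1 nu2 (t : R),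
           [/\ Nbeta beta nu1 /\ Nbeta beta nu2, ~ proportional nu1 nu2,
               0 < t < 1,
               nu = t *: nu1 + (1 - t) *: nu2 &
               sigma_affine_on_segment X alpha nu1 nu2])].

Definition Lambda (X : set 'rV[R]_n) (alpha : 'I_m -> 'rV[R]_n) : set 'rV[R]_m :=
  [set lam : 'rV[R]_m | exists beta, Xcircuit X alpha beta lam /\ lam 0 beta = -1].

Definition phi (X : set 'rV[R]_n) (alpha : 'I_m -> 'rV[R]_n) (lam : 'rV[R]_m)
  : 'rV[R]_m * R := (lam, fine (sigmaX X (- Amul alpha lam))).

End Defs.

Definition conic_hull (R : realType) (V : lmodType R) (S : set V) : set V :=
  [set v | exists k (w : 'I_k -> R) (p : 'I_k -> V),
     [/\ forall j, 0 <= w j, forall j, S (p j) & v = \sum_(j < k) w j *: p j]].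

Definition conv_hull (R : realType) (V : lmodType R) (S : set V) : set V :=
  [set v | exists k (w : 'I_k -> R) (p : 'I_k -> V),
     [/\ forall j, 0 <= w j, \sum_(j < k) w j = 1, forall j, S (p j) &
         v = \sum_(j < k) w j *: p j]].

Definition extreme_ray (R : realType) (V : lmodType R) (K : set V) (u : V) : Prop :=
  let ray := [set t *: u | t in [set t : R | 0 <= t]] in
  [/\ u != 0, ray `<=` K &
      forall v w, K v -> K w -> ray (v + w) -> ray v /\ ray w].

Section Defs2.
Variables (R : realType) (n m : nat).
Implicit Types (X : set 'rV[R]_n) (alpha : 'I_m -> 'rV[R]_n).

Definition circuit_graph X alpha : set ('rV[R]_m * R) :=
  conic_hull ([set phi X alpha lam | lam in Lambda X alpha] `|` [set (0, 1)]).

Definition Lambda_star X alpha : set 'rV[R]_m :=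
  [set lam : 'rV[R]_m | Lambda X alpha lam /\ extreme_ray (circuit_graph X alpha) (phi X alpha lam)].

Definition signomial alpha (c : 'rV[R]_m) (x : 'rV[R]_n) : R :=
  \sum_(i < m) c 0 i * expR (dotp (alpha i) x).

Definition AGE_cone X alpha (beta : 'I_m) : set 'rV[R]_m :=
  [set c : 'rV[R]_m | (forall i, i != beta -> 0 <= c 0 i) /\
           (forall x, X x -> 0 <= signomial alpha c x)].

Definition SAGE_cone X alpha : set 'rV[R]_m :=
  [set c : 'rV[R]_m | exists f : 'I_m -> 'rV[R]_m,
     (forall beta, AGE_cone X alpha beta (f beta)) /\ c = \sum_(beta < m) f beta].

(* lambda-witnessed AGE cone C_X(A, lambda); beta is the (unique) negative index *)
Definition lambda_AGE_cone X alpha (lam : 'rV[R]_m) : set 'rV[R]_m :=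
  [set c : 'rV[R]_m | exists beta, lam 0 beta < 0 /\
     (forall i, i != beta -> 0 <= c 0 i) /\
     \prod_(i < m | 0 < lam 0 i) ((c 0 i / lam 0 i) `^ (lam 0 i))
       >= - c 0 beta * expR (fine (sigmaX X (- Amul alpha lam)))].

Definition orthant : set 'rV[R]_m := [set c : 'rV[R]_m | forall i, 0 <= c 0 i].

End Defs2.

(* Main.v *)
Require Import Defs.
From HB Require Import structures.
From mathcomp Require Import all_boot all_order all_algebra finmap.
From mathcomp Require Import all_classical all_reals all_analysis.
From mathcomp Require Import ring lra.
Set Implicit Arguments. Unset Strict Implicit. Unset Printing Implicit Defensive.
Import Order.TTheory GRing.Theory Num.Theory.
Import numFieldNormedType.Exports.
Local Open Scope ring_scope.
Local Open Scope classical_set_scope.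

(* Let E_b be the epigraph of nu |-> sigma_X(-A nu) over N_b and K the sum of
   the E_b.  Linear independence forces elements of the E_b adding up to 0 to
   vanish, so K is a closed pointed cone; a linear functional negative
   somewhere on K is then negative on an extreme ray of K, and such a ray is
   spanned by phi_lambda with lambda reduced.
   A point c of C_X(A) outside the closed convex hull is separated from it by
   some v, which may be taken positive after adding a small multiple of
   (exp(alpha^T x0))_alpha.  Testing v on the lambda-witnessed cones says that
   (ln v, 1) is nonnegative on phi_lambda for every reduced lambda, hence on K,
   and a second separation argument turns this into v . c >= 0, a
   contradiction.  The reverse inclusion is the weighted AM-GM inequality and
   the closedness of C_X(A). *)

(** * Bilinearity and definiteness of the inner product *)

Section InnerProduct.
Context {R : realType} {n : nat}.
Implicit Types x y z : 'rV[R]_n.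

Lemma dotpC x y : dotp x y = dotp y x.
Proof. by apply: eq_bigr => i _; rewrite mulrC. Qed.

Lemma dotpDr z x y : dotp z (x + y) = dotp z x + dotp z y.
Proof. by rewrite -big_split; apply: eq_bigr => i _; rewrite mxE mulrDr. Qed.

Lemma dotpZr z a x : dotp z (a *: x) = a * dotp z x.
Proof. by rewrite big_distrr; apply: eq_bigr => i _; rewrite mxE mulrCA. Qed.

Lemma dotpNr z x : dotp z (- x) = - dotp z x.
Proof. by rewrite -scaleN1r dotpZr mulN1r. Qed.

Lemma dotpBr z x y : dotp z (x - y) = dotp z x - dotp z y.
Proof. by rewrite dotpDr dotpNr. Qed.

Lemma dotp0r z : dotp z 0 = 0.
Proof. by rewrite -(scale0r 0) dotpZr mul0r. Qed.

Lemma dotp_sumr z I (r : seq I) (P : pred I) F :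
  dotp z (\sum_(i <- r | P i) F i) = \sum_(i <- r | P i) dotp z (F i).
Proof. by apply: (big_morph (dotp z)); [exact: dotpDr|exact: dotp0r]. Qed.

Lemma dotpDl z x y : dotp (x + y) z = dotp x z + dotp y z.
Proof. by rewrite dotpC dotpDr !(dotpC z). Qed.

Lemma dotpZl z a x : dotp (a *: x) z = a * dotp x z.
Proof. by rewrite dotpC dotpZr (dotpC z). Qed.

Lemma dotpNl z x : dotp (- x) z = - dotp x z.
Proof. by rewrite dotpC dotpNr dotpC. Qed.

Lemma dotpBl z x y : dotp (x - y) z = dotp x z - dotp y z.
Proof. by rewrite dotpDl dotpNl. Qed.

Lemma dotp_suml z I (r : seq I) (P : pred I) F :
  dotp (\sum_(i <- r | P i) F i) z = \sum_(i <- r | P i) dotp (F i) z.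
Proof. by rewrite dotpC dotp_sumr; apply: eq_bigr => i _; rewrite dotpC. Qed.

Lemma dotpxx_ge0 x : 0 <= dotp x x.
Proof. by apply: sumr_ge0 => i _; rewrite -expr2 sqr_ge0. Qed.

Lemma dotpxx_eq0 x : dotp x x = 0 -> x = 0.
Proof.
move=> /eqP; rewrite psumr_eq0; last by move=> i _; rewrite -expr2 sqr_ge0.
move=> /allP x0; apply/rowP => i; rewrite mxE.
by have := x0 i (mem_index_enum _); rewrite /= mulf_eq0 orbb => /eqP.
Qed.

Lemma dotp_delta x i : dotp x (delta_mx 0 i) = x 0 i.
Proof.
rewrite /dotp (bigD1 i)//= big1 ?addr0; first by rewrite mxE !eqxx mulr1.
by move=> j ji; rewrite mxE (negPf ji) andbF mulr0.
Qed.

End InnerProduct.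

(** * Continuity, closedness and compactness in finite dimension *)

Lemma continuous_bigsum (R : realType) (T : topologicalType)
    (V : normedModType R) I (r : seq I) (F : I -> T -> V) :
  (forall i, continuous (F i)) -> continuous (fun x => \sum_(i <- r) F i x).
Proof.
move=> Fc x; elim: r => [|i r IH].
  have -> : (fun x => \sum_(i <- [::]) F i x) = cst 0.
    by apply/funext => y; rewrite big_nil.
  exact: cvg_cst.
have -> : (fun x => \sum_(i <- i :: r) F i x) = F i \+ (fun x => \sum_(i <- r) F i x).
  by apply/funext => y; rewrite big_cons.
by apply: cvgD => //; exact: Fc.
Qed.

Lemma linear_rV_continuous (R : realType) p (V : normedModType R)
    (f : {linear 'rV[R]_p -> V}) : continuous f.
Proof.
have -> : f = (fun x => \sum_i x 0 i *: f (delta_mx 0 i)) :> (_ -> _).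
  apply/funext => x; rewrite {1}(row_sum_delta x) linear_sum.
  by apply: eq_bigr => i _; rewrite linearZ.
apply: continuous_bigsum => i x; apply: continuousZr_tmp.
exact: coord_continuous.
Qed.

Lemma dotp_continuous (R : realType) n (v : 'rV[R]_n) : continuous (dotp v).
Proof.
apply: (@continuous_bigsum R _ R^o) => i x.
by apply: continuousM; [exact: cst_continuous|exact: coord_continuous].
Qed.

Lemma dotpxx_continuous (R : realType) n : continuous (fun x : 'rV[R]_n => dotp x x).
Proof.
apply: (@continuous_bigsum R _ R^o) => i x.
by apply: continuousM; exact: coord_continuous.
Qed.

Lemma closed_fun_ge (R : realType) (T : topologicalType) (f : T -> R) a :
  continuous f -> closed [set x | a <= f x].
Proof.
move=> fc; apply: (@preimage_closed _ _ f [set y | a <= y]); last exact: closed_ge.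
by move=> x _; exact: fc.
Qed.

Lemma closed_fun_le (R : realType) (T : topologicalType) (f : T -> R) a :
  continuous f -> closed [set x | f x <= a].
Proof.
move=> fc; apply: (@preimage_closed _ _ f [set y | y <= a]); last exact: closed_le.
by move=> x _; exact: fc.
Qed.

Lemma closed_fun_eq (R : realType) (T : topologicalType) (f : T -> R) a :
  continuous f -> closed [set x | f x = a].
Proof.
move=> fc; apply: (@preimage_closed _ _ f [set y | y = a]); last exact: closed_eq.
by move=> x _; exact: fc.
Qed.

Lemma bounded_le_set (R : realType) (V : normedModType R) (A : set V) (M : R) :
  (forall x, A x -> `|x| <= M) -> bounded_set A.
Proof.
move=> AM; exists M; split; first exact: num_real.
by move=> N MN x Ax /=; rewrite (le_trans (AM _ Ax))// ltW.
Qed.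

Lemma EVT_min_continuous (R : realType) n (f : 'rV[R]_n -> R) (A : set 'rV[R]_n) :
    A !=set0 -> compact A -> continuous f ->
  exists2 c, A c & forall x, A x -> f c <= f x.
Proof.
move=> A0 cA fc.
have [c cA' cmin] := EVT_min_rV A0 cA (continuous_subspaceT fc).
by exists c; [rewrite inE in cA'|move=> x Ax; apply: cmin; rewrite inE].
Qed.

(** * Closedness of linear images and sums of cones *)

Definition convex_cone {R : realType} {V : lmodType R} (K : set V) :=
  [/\ K 0, forall x y, K x -> K y -> K (x + y) &
      forall (a : R) x, 0 <= a -> K x -> K (a *: x)].

(** Since f has no zero on the compact set of unit vectors of L, homogeneity gives d > 0 with d |x|
    <= |f x| on L. Image points near z then come from a bounded, hence compact, part of L. *)
Lemma closed_linear_image (R : realType) p q (f : {linear 'rV[R]_p -> 'rV[R]_q})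
    (L : set 'rV[R]_p) :
  closed L -> (forall (a : R) x, 0 <= a -> L x -> L (a *: x)) ->
  (forall x, L x -> f x = 0 -> x = 0) -> closed (f @` L).
Proof.
move=> Lcl Lcone Lker.
have fc := @linear_rV_continuous R _ _ f.
have nfc : continuous (fun x => `|f x|).
  by move=> x; apply: (cvg_norm (fc x)).
have [d d0 dP] : exists2 d : R, 0 < d & forall x, L x -> d * `|x| <= `|f x|.
  pose T := L `&` [set x | `|x| = 1].
  have LT x : L x -> x != 0 -> T (`|x|^-1 *: x).
    move=> Lx x0; split; first by apply: Lcone => //; rewrite invr_ge0.
    by rewrite /= normrZ normfV normr_id mulVf// normr_eq0.
  have [T0|/set0P T0] := eqVneq T set0.
    exists 1 => // x Lx; have [->|x0] := eqVneq x 0; first by rewrite normr0 mulr0.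
    by have := LT _ Lx x0; rewrite T0.
  have Tc : compact T.
    apply: bounded_closed_compact.
      by apply: (@bounded_le_set _ _ _ 1) => x [_ /= ->].
    apply: closedI => //; apply: closed_fun_eq; exact: norm_continuous.
  have [c [Lc c1] cmin] := EVT_min_continuous T0 Tc nfc.
  exists `|f c|.
    rewrite normr_gt0; apply/eqP => /Lker-/(_ Lc) c0.
    by move: c1; rewrite c0 /= normr0 => /esym/eqP; rewrite oner_eq0.
  move=> x Lx; have [->|x0] := eqVneq x 0; first by rewrite normr0 mulr0.
  have := cmin _ (LT _ Lx x0); rewrite linearZ normrZ normfV normr_id.
  by rewrite ler_pdivlMl ?normr_gt0// mulrC.
move=> z zcl.
(* An image point within distance 1 of z has norm at most |z| + 1, so its preimages in L have norm
   at most [M]. *)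
pose M := (`|z| + 1) / d.
pose LM := L `&` [set x | `|x| <= M].
have LMc : compact LM.
  apply: bounded_closed_compact; first by apply: (@bounded_le_set _ _ _ M) => x [].
  apply: closedI => //.
  by apply: closed_fun_le; exact: norm_continuous.
have fLMc : closed (f @` LM).
  apply: compact_closed; first exact: norm_hausdorff.
  by apply: continuous_compact => //; apply: continuous_subspaceT.
suff : (f @` LM) z by case=> x [Lx _] <-; exists x.
apply: fLMc => B Bz.
have [y [[x Lx <-] [Bfx zfx]]] := zcl _ (filterI Bz (nbhsx_ballx z 1 ltr01)).
exists (f x); split => //; exists x => //; split => //=.
rewrite /M ler_pdivlMr// mulrC (le_trans (dP _ Lx))//.
have : `|z - f x| < 1 by rewrite -ball_normE in zfx.
move=> zf; rewrite -[f x](subrK z) (le_trans (ler_normD _ _))//.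
by rewrite addrC lerD2l distrC ltW.
Qed.

Definition setsum {R : realType} {V : lmodType R} {k} (K : 'I_k -> set V) : set V :=
  [set z | exists x : 'I_k -> V, (forall i, K i (x i)) /\ z = \sum_i x i].

(** The sum is the image of the product cone under addition. The product lives in flattened k x p
    matrices, one row per summand, and the last hypothesis says that addition has trivial kernel on
    it. *)
Lemma closed_setsum (R : realType) k p (K : 'I_k -> set 'rV[R]_p) :
  (forall i, closed (K i)) -> (forall i, convex_cone (K i)) ->
  (forall x : 'I_k -> 'rV[R]_p, (forall i, K i (x i)) -> \sum_i x i = 0 ->
     forall i, x i = 0) ->
  closed (setsum K).
Proof.
move=> Kcl Kco K0.
pose rw i := row i \o @vec_mx R k p.
pose f : {linear 'rV[R]_(k * p) -> 'rV[R]_p} := mulmx (const_mx 1) \o vec_mx.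
have fE x : f x = \sum_i rw i x.
  apply/rowP => j; rewrite /= mxE summxE; apply: eq_bigr => i _.
  by rewrite !mxE mul1r.
pose L := [set x | forall i, K i (rw i x)].
have -> : setsum K = f @` L.
  apply/seteqP; split => [z [x [Kx ->]]|z [x Lx <-]]; last first.
    by exists (rw^~ x); rewrite fE.
  have xE i : rw i (mxvec (\matrix_i x i)) = x i by rewrite /rw /= mxvecK rowK.
  exists (mxvec (\matrix_i x i)); first by move=> i; rewrite xE.
  by rewrite fE; apply: eq_bigr => i _; rewrite xE.
apply: closed_linear_image.
- have -> : L = \bigcap_i (rw i @^-1` K i).
    by apply/seteqP; split => x Lx i; [move=> _; exact: Lx|exact: (Lx i I)].
  apply: closed_bigI => i _; apply: preimage_closed => // x _.
  exact: (@linear_rV_continuous _ _ _ (row i \o @vec_mx R k p)).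
- move=> a x a0 Lx i; rewrite /rw /= !linearZ /=.
  by have [_ _] := Kco i; apply.
- move=> x Lx; rewrite fE => /(K0 _ Lx) x0.
  apply: (can_inj vec_mxK); rewrite linear0; apply/row_matrixP => i.
  by rewrite row0; exact: x0.
Qed.

(** * Separation of a point from a convex set *)

(** The norm on row vectors is the sup norm; this crude comparison suffices to bound sublevel sets
    of the Euclidean distance. *)
Lemma norm_le_dotp (R : realType) n (x : 'rV[R]_n) : `|x| <= 1 + dotp x x.
Proof.
have x2 := dotpxx_ge0 x.
have [->|x0] := eqVneq x 0; first by rewrite normr0 addr_ge0// dotpxx_ge0.
have /mx_norm_neq0[[j i] /=] : mx_norm x != 0 by apply: contra_neq x0; exact: mx_norm_eq0.
rewrite ord1 -[mx_norm x]/(`|x|) => ->.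
have : `|x 0 i| ^+ 2 <= dotp x x.
  rewrite real_normK ?num_real// /dotp (bigD1 i)//= -expr2 lerDl.
  by apply: sumr_ge0 => k _; rewrite -expr2 sqr_ge0.
by have := sqr_ge0 (`|x 0 i| - 1); nra.
Qed.

Lemma convex_closure (R : realType) n (C : set 'rV[R]_n) :
  convex_setR C -> convex_setR (closure C).
Proof.
move=> Cc x y t Cx Cy t01 B /nbhs_ballP[e /= e0 eB].
have e2 : 0 < e / 2 by rewrite divr_gt0.
have [u [Cu xu]] := Cx _ (nbhsx_ballx x _ e2).
have [w [Cw yw]] := Cy _ (nbhsx_ballx y _ e2).
exists (t *: u + (1 - t) *: w); split; first exact: Cc.
apply: eB; rewrite -ball_normE /= in xu yw *.
have -> : t *: x + (1 - t) *: y - (t *: u + (1 - t) *: w) =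
    t *: (x - u) + (1 - t) *: (y - w) by apply/rowP => i; rewrite !mxE; ring.
move: t01 => /andP[t0 t1].
rewrite (le_lt_trans (ler_normD _ _))// !normrZ !ger0_norm ?subr_ge0//.
by nra.
Qed.

(** The vector v runs from p to a nearest point q of the closure of C, which exists by compactness.
    The term v . v makes the separation strict. *)
Lemma separation (R : realType) n (C : set 'rV[R]_n) p :
  C !=set0 -> convex_setR C -> ~ closure C p ->
  exists v, v != 0 /\ forall c, C c -> dotp v p + dotp v v <= dotp v c.
Proof.
move=> [c0 Cc0] Ccvx Cp.
pose g c := dotp (c - p) (c - p).
have gc : continuous g.
  move=> x; have := @continuous_comp _ _ _
    (fun y : 'rV[R]_n => y - p) (fun y => dotp y y) x; apply.
    by apply: continuousB; [exact: cvg_id|exact: cst_continuous].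
  exact: dotpxx_continuous.
pose A := closure C `&` [set c | g c <= g c0].
have Ac : compact A.
  apply: bounded_closed_compact.
    apply: (@bounded_le_set _ _ _ (1 + g c0 + `|p|)) => x [_ /= gx].
    rewrite -{1}(subrK p x) (le_trans (ler_normD _ _))// lerD2r.
    by rewrite (le_trans (norm_le_dotp _))// lerD2l.
  by apply: closedI; [exact: closed_closure|exact: closed_fun_le].
have A0 : A !=set0 by exists c0; split => //=; exact: subset_closure.
have [q [Cq gq] qmin] := EVT_min_continuous A0 Ac gc.
have qminC c : closure C c -> g q <= g c.
  move=> Cc; have [cc0|/ltW cc0] := leP (g c) (g c0); first exact: qmin.
  exact: le_trans gq cc0.
exists (q - p); split.
  by apply/eqP => /eqP; rewrite subr_eq0 => /eqP qp; rewrite -qp in Cp.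
move=> c Cc; set v := q - p.
suff vw : 0 <= dotp v (c - q).
  have -> : dotp v c = dotp v p + dotp v v + dotp v (c - q).
    by rewrite -!dotpDr; congr dotp; apply/rowP => i; rewrite /v !mxE; ring.
  by rewrite lerDl.
rewrite leNgt; apply/negP => vw.
set w := c - q in vw; set a := - dotp v w; set b := dotp w w.
have a0 : 0 < a by rewrite oppr_gt0.
have b0 : 0 <= b by exact: dotpxx_ge0.
have ab0 : 0 < a + b by rewrite ltr_pwDl.
(* This step length gives |v + t w|^2 - |v|^2 = - 2 t a + t^2 b = - t a - t^2 a < 0, so moving from
   q towards c would come closer to p. *)
set t := a / (a + b).
have t0 : 0 < t by rewrite divr_gt0.
have t1 : t <= 1 by rewrite ler_pdivrMr// mul1r lerDl.
have : g q <= g (t *: c + (1 - t) *: q).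
  apply: qminC; apply: convex_closure => //; last by rewrite t1 ltW.
  exact: subset_closure.
have -> : g (t *: c + (1 - t) *: q) = dotp (v + t *: w) (v + t *: w).
  by rewrite /g; congr dotp; apply/rowP => i; rewrite /v /w !mxE; ring.
rewrite /g -/v; clearbody v; rewrite dotpDr !dotpDl !dotpZr !dotpZl (dotpC w v) -/b.
have -> : dotp v w = - a by rewrite /a opprK.
have tab : t * (a + b) = a by rewrite /t divfK// gt_eqF.
have ttb : t * (t * b) = t * a - t * (t * a) by rewrite -{1}tab; ring.
have ta0 : 0 < t * a by exact: mulr_gt0.
have tta0 : 0 < t * (t * a) by exact: mulr_gt0.
by rewrite ttb; lra.
Qed.

(** * Pointed closed cones and their extreme rays *)

(** Turns a lower bound of a functional on a cone into nonnegativity there. *)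
Lemma ge0_of_scaled_bound (R : realType) (m r : R) :
  (forall a, 0 <= a -> m <= a * r) -> 0 <= r.
Proof.
move=> mr; rewrite leNgt; apply/negP => r0.
have : m <= ((`|m| + 1) / - r) * r.
  by apply: mr; rewrite divr_ge0 ?addr_ge0// oppr_ge0 ltW.
rewrite invrN mulrN mulNr divfK ?lt_eqF//.
by have := ler_norm (- m); rewrite normrN; lra.
Qed.

Lemma convex_cone_convex (R : realType) n (K : set 'rV[R]_n) :
  convex_cone K -> convex_setR K.
Proof.
move=> [_ Kadd Kscale] x y t Kx Ky /andP[t0 t1].
by apply: Kadd; apply: Kscale => //; rewrite subr_ge0.
Qed.

Section PointedCone.
Context {R : realType} {n : nat}.
Variable K : set 'rV[R]_n.
Hypotheses (Kcl : closed K) (Kco : convex_cone K).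
Hypothesis Kpt : forall x, K x -> K (- x) -> x = 0.

Let sphere := K `&` [set x | `|x| = 1].

Let sphere_compact : compact sphere.
Proof.
apply: bounded_closed_compact.
  by apply: (@bounded_le_set _ _ _ 1) => x [_ /= ->].
by apply: closedI => //; apply: closed_fun_eq; exact: norm_continuous.
Qed.

Let sphere_scale x : K x -> x != 0 -> sphere (`|x|^-1 *: x).
Proof.
case: Kco => _ _ Ks Kx x0; split; first by apply: Ks => //; rewrite invr_ge0.
by rewrite /= normrZ normfV normr_id mulVf// normr_eq0.
Qed.

(* Each point x of the compact set [sphere] is separated from -x by a
   functional nonnegative on K; finitely many of these cover [sphere],
   and their sum is positive on all of it. *)
Lemma pointed_cone_functional :
  exists e : 'rV[R]_n, forall x, K x -> x != 0 -> 0 < dotp e x.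
Proof.
have [K0 Kadd Ks] := Kco.
pose D := [set v : 'rV[R]_n | forall x, K x -> 0 <= dotp v x].
pose f (v : 'rV[R]_n) := [set x | 0 < dotp v x].
have := sphere_compact; rewrite compact_cover.
case/(_ _ D f) => [v _|x [Kx /= x1]|D' D'D sphD'].
- have -> : f v = ~` [set x | dotp v x <= 0].
    by apply/seteqP; split => x; rewrite /f /= ltNge => /negP.
  by apply: closed_openC; apply: closed_fun_le; exact: dotp_continuous.
- have x0 : x != 0 by rewrite -normr_gt0 x1.
  have KNx : ~ closure K (- x).
    move=> /Kcl KNx; move: x0; rewrite (Kpt Kx KNx) eqxx; exact: notF.
  have [v [v0 vP]] := separation (ex_intro _ _ K0) (convex_cone_convex Kco) KNx.
  exists v => /=.
    move=> y Ky; apply: (@ge0_of_scaled_bound _ (dotp v (- x) + dotp v v)) => a a0.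
    by rewrite -dotpZr; apply: vP; exact: Ks.
  have := vP _ K0; rewrite dotp0r dotpNr addrC subr_le0; apply: lt_le_trans.
  rewrite lt_neqAle dotpxx_ge0 andbT eq_sym.
  by apply: contra_neq v0; exact: dotpxx_eq0.
exists (\sum_(v <- D') v) => x Kx x0.
have [v vD' vx] := sphD' _ (sphere_scale Kx x0).
rewrite /f /= dotpZr pmulr_rgt0 ?invr_gt0 ?normr_gt0// in vx.
rewrite dotp_suml (big_fsetD1 v)//= (lt_le_trans vx)// lerDl.
rewrite big_seq; apply: sumr_ge0 => w; rewrite inE => /andP[_ /D'D/set_mem wD].
exact: wD.
Qed.

(* The witness is the farthest point from the origin among the minimizers of
   the functional l on a compact base of K. *)
Lemma extreme_ray_lt0 (l k : 'rV[R]_n) : K k -> dotp l k < 0 ->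
  exists u, [/\ K u, dotp l u < 0 &
    forall v w s, K v -> K w -> v + w = s *: u ->
      exists2 a, 0 <= a & v = a *: u].
Proof.
move=> Kk lk; have [K0 Kadd Ks] := Kco.
have [e eP] := pointed_cone_functional.
have k0 : k != 0 by apply: contraTneq lk => ->; rewrite dotp0r ltxx.
have S0 : sphere !=set0 by exists (`|k|^-1 *: k); exact: sphere_scale.
have [c [Kc /= c1] cmin] := EVT_min_continuous S0 sphere_compact (@dotp_continuous _ _ e).
have c0 : c != 0 by rewrite -normr_gt0 c1.
have d0 : 0 < dotp e c := eP _ Kc c0.
pose B := K `&` [set x | dotp e x = 1].
have toB x : K x -> x != 0 -> B ((dotp e x)^-1 *: x).
  move=> Kx x0; have ex := eP _ Kx x0; split; first by apply: Ks => //; rewrite invr_ge0 ltW.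
  by rewrite /= dotpZr mulVf// gt_eqF.
have Bcl : closed B by apply: closedI => //; apply: closed_fun_eq; exact: dotp_continuous.
have Bbd x : B x -> `|x| <= (dotp e c)^-1.
  move=> [Kx /= ex].
  have x0 : x != 0 by apply: contra_eq_neq ex => ->; rewrite dotp0r eq_sym oner_eq0.
  have := cmin _ (sphere_scale Kx x0); rewrite dotpZr ex mulr1 => h.
  by rewrite -[leLHS]invrK lef_pV2// posrE ?invr_gt0 ?normr_gt0.
have Bc : compact B.
  by apply: bounded_closed_compact => //; exact: bounded_le_set Bbd.
have B0 : B !=set0 by eexists; exact: toB Kk k0.
have [q Bq qmin] := EVT_min_continuous B0 Bc (@dotp_continuous _ _ l).
pose F := B `&` [set x | dotp l x = dotp l q].
have Fc : compact F.
  apply: compact_closedI => //; apply: closed_fun_eq; exact: dotp_continuous.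
have F0 : F !=set0 by exists q.
have [u [[Ku /= eu] /= lu] umax] := EVT_min_continuous (f := fun x => - dotp x x) F0 Fc
  (fun x => continuousN (@dotpxx_continuous _ _ x)).
have lu0 : dotp l u < 0.
  rewrite lu; apply: le_lt_trans (qmin _ (toB _ Kk k0)) _.
  by rewrite dotpZr nmulr_llt0// invr_gt0 eP.
exists u; split => // v w s Kv Kw vws.
have [v0|v0] := eqVneq v 0; first by exists 0; rewrite ?scale0r.
have [w0|w0] := eqVneq w 0.
  exists s; last by rewrite -vws w0 addr0.
  have := eP _ Kv v0; have -> : v = s *: u by rewrite -vws w0 addr0.
  by rewrite dotpZr eu mulr1 => /ltW.
set a := dotp e v; set b := dotp e w.
have a0 : 0 < a := eP _ Kv v0.
have b0 : 0 < b := eP _ Kw w0.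
have sab : s = a + b by rewrite -[s]mulr1 -eu -dotpZr -vws dotpDr.
have Bv := toB _ Kv v0; have Bw := toB _ Kw w0.
set v' := a^-1 *: v in Bv *; set w' := b^-1 *: w in Bw *.
have vE : v = a *: v' by rewrite /v' scalerA divff ?scale1r// gt_eqF.
have wE : w = b *: w' by rewrite /w' scalerA divff ?scale1r// gt_eqF.
clearbody v' w'.
have suE : a *: v' + b *: w' = (a + b) *: u by rewrite -sab -vws -vE -wE.
(* The weighted mean of the values of [l] at v' and w' is the minimum of [l] on the base, so both
   points lie in the face [F]. *)
have ll : a * dotp l v' + b * dotp l w' = (a + b) * dotp l q.
  by rewrite -!dotpZr -dotpDr suE !dotpZr lu.
have lv := qmin _ Bv; have lw := qmin _ Bw.
have alv : a * dotp l q <= a * dotp l v' by rewrite ler_pM2l.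
have blw : b * dotp l q <= b * dotp l w' by rewrite ler_pM2l.
have lv' : dotp l v' = dotp l q.
  by apply/eqP; rewrite eq_le lv andbT -(ler_pM2l a0); lra.
have lw' : dotp l w' = dotp l q.
  by apply/eqP; rewrite eq_le lw andbT -(ler_pM2l b0); lra.
have := umax _ (conj Bv lv'); have := umax _ (conj Bw lw').
rewrite !lerN2 => uw uv.
(* Strict convexity of the squared norm: u is a weighted mean of v' and w', neither of which is
   farther from the origin than u, so the defect term must vanish and v' = w'. *)
have uu : (a + b) ^+ 2 * dotp u u =
    (a + b) * (a * dotp v' v' + b * dotp w' w') - a * b * dotp (v' - w') (v' - w').
  have -> : (a + b) ^+ 2 * dotp u u = dotp ((a + b) *: u) ((a + b) *: u).
    by rewrite dotpZl dotpZr; ring.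
  rewrite -suE.
  rewrite !dotpDl !dotpDr !dotpZl !dotpZr !dotpNl !dotpNr (dotpC w' v').
  ring.
have vw0 : v' - w' = 0.
  apply: dotpxx_eq0; apply/eqP; rewrite eq_le dotpxx_ge0 andbT.
  rewrite -(pmulr_rle0 _ (mulr_gt0 a0 b0)).
  have : a * b * dotp (v' - w') (v' - w') =
    (a + b) * (a * dotp v' v' + b * dotp w' w') - (a + b) ^+ 2 * dotp u u by rewrite uu; ring.
  move=> ->.
  have h1 : a * dotp v' v' <= a * dotp u u by rewrite ler_pM2l.
  have h2 : b * dotp w' w' <= b * dotp u u by rewrite ler_pM2l.
  nra.
exists a; first exact: ltW.
rewrite vE; congr (_ *: _).
have vw : w' = v' by apply/esym/eqP; rewrite -subr_eq0 vw0.
move: suE; rewrite vw -scalerDl => /(congr1 ( *:%R (a + b)^-1)).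
by rewrite !scalerA mulVf ?scale1r// gt_eqF// addr_gt0.
Qed.

End PointedCone.

(** * Pairs in R^A x R encoded as row vectors *)

Section Pack.
Context {R : realType} {m : nat}.
Implicit Types (p q : 'rV[R]_m * R) (z : 'rV[R]_(m + 1)).

Definition pack p : 'rV[R]_(m + 1) := row_mx p.1 p.2%:M.
(** The lock keeps simplification from exposing the submatrices, so that rewriting goes through
    [packK] and [unpackK]. *)
Definition unpack z : 'rV[R]_m * R := locked (lsubmx z, rsubmx z 0 0).

Lemma packK : cancel pack unpack.
Proof. by case=> nu t; rewrite /pack /unpack -lock row_mxKl row_mxKr mxE eqxx. Qed.

Lemma unpackK : cancel unpack pack.
Proof.
move=> z; rewrite /pack /unpack -lock -[RHS]hsubmxK; congr row_mx.
by rewrite /= -mx11_scalar.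
Qed.

Lemma packD p q : pack (p + q) = pack p + pack q.
Proof. rewrite /pack add_row_mx; congr row_mx; exact: (raddfD (@scalar_mx R 1)). Qed.

Lemma packZ (a : R) p : pack (a *: p) = a *: pack p.
Proof. by rewrite /pack scale_row_mx scale_scalar_mx. Qed.

Lemma pack0 : pack 0 = 0.
Proof. by rewrite -(scale0r (0 : 'rV[R]_m * R)) packZ scale0r. Qed.

Lemma unpack0 : unpack (0 : 'rV[R]_(m + 1)) = 0.
Proof. by apply: (can_inj packK); rewrite unpackK pack0. Qed.

Lemma pack_sum I (r : seq I) (P : pred I) F :
  pack (\sum_(i <- r | P i) F i) = \sum_(i <- r | P i) pack (F i).
Proof. by apply: big_morph; [exact: packD|exact: pack0]. Qed.

Lemma unpack_sum I (r : seq I) (P : pred I) F :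
  unpack (\sum_(i <- r | P i) F i) = \sum_(i <- r | P i) unpack (F i).
Proof.
by apply: (can_inj packK); rewrite unpackK pack_sum; apply: eq_bigr => i _; rewrite unpackK.
Qed.

Lemma dotp_pack p q : dotp (pack p) (pack q) = dotp p.1 q.1 + p.2 * q.2.
Proof.
rewrite /dotp big_split_ord big_ord1 /=; congr (_ + _).
  by apply: eq_bigr => i _; rewrite !row_mxEl.
by rewrite !row_mxEr !mxE !eqxx.
Qed.

End Pack.

(** * Epigraphs of the support function and their sum *)

Section Circuits.
Context {R : realType} {n m : nat}.
Variables (X : set 'rV[R]_n) (alpha : 'I_m -> 'rV[R]_n).
Implicit Types (nu : 'rV[R]_m) (x : 'rV[R]_n) (b : 'I_m).

Lemma dotp_Amul nu x : dotp (Amul alpha nu) x = \sum_i nu 0 i * dotp (alpha i) x.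
Proof. by rewrite dotp_suml; apply: eq_bigr => i _; rewrite dotpZl. Qed.

Lemma dotp_row nu x : dotp (\row_i dotp (alpha i) x) nu = dotp (Amul alpha nu) x.
Proof. by rewrite dotp_Amul; apply: eq_bigr => i _; rewrite mxE mulrC. Qed.

Lemma AmulD nu nu' : Amul alpha (nu + nu') = Amul alpha nu + Amul alpha nu'.
Proof. by rewrite -big_split; apply: eq_bigr => i _; rewrite mxE scalerDl. Qed.

Lemma AmulZ a nu : Amul alpha (a *: nu) = a *: Amul alpha nu.
Proof. by rewrite scaler_sumr; apply: eq_bigr => i _; rewrite mxE scalerA. Qed.

Lemma Amul0 : Amul alpha 0 = 0.
Proof. by rewrite -(scale0r 0) AmulZ scale0r. Qed.

Lemma sigmaX_le (y : 'rV[R]_n) (t : R) :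
  (sigmaX X y <= t%:E)%E <-> forall x, X x -> dotp y x <= t.
Proof.
split=> [yt x Xx|yt].
  by rewrite -lee_fin (le_trans _ yt)//; apply: ereal_sup_ubound; exists x.
by apply: ge_ereal_sup => _ [x Xx <-]; rewrite lee_fin; exact: yt.
Qed.

Lemma Nbeta_cone b : convex_cone (@Nbeta R m b).
Proof.
split=> [|nu nu' [nu0 snu] [nu'0 snu']|a nu a0 [nu0 snu]].
- by split=> [i _|]; rewrite ?mxE// big1// => i _; rewrite mxE.
- split=> [i ib|]; first by rewrite mxE addr_ge0 ?nu0 ?nu'0.
  by under eq_bigr do rewrite mxE; rewrite big_split /= snu snu' addr0.
- split=> [i ib|]; first by rewrite mxE mulr_ge0 ?nu0.
  by under eq_bigr do rewrite mxE; rewrite -big_distrr /= snu mulr0.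
Qed.

Lemma Nbeta_neg b nu : Nbeta b nu -> nu != 0 -> nu 0 b < 0.
Proof.
move=> [nu0 snu]; rewrite ltNge; apply: contraNN => b0; apply/eqP/rowP => i.
have nu_ge0 j : 0 <= nu 0 j by have [->//|/nu0] := eqVneq j b.
move/eqP: snu; rewrite psumr_eq0// => /allP/(_ i (mem_index_enum _))/= /eqP ->.
by rewrite mxE.
Qed.

(** Stating the bound pointwise on X instead of through the extended-real supremum presents the
    epigraph as an intersection of closed half-spaces and a hyperplane; a nu of infinite support
    value contributes no point. *)
Definition epi_sigma b : set 'rV[R]_(m + 1) :=
  [set z | Nbeta b (unpack z).1 /\
    forall x, X x -> dotp (- Amul alpha (unpack z).1) x <= (unpack z).2].

Lemma pack_epi b nu t : epi_sigma b (pack (nu, t)) <->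
  Nbeta b nu /\ (sigmaX X (- Amul alpha nu) <= t%:E)%E.
Proof. by rewrite /epi_sigma /= packK /= sigmaX_le. Qed.

Lemma epi_sigma_cone b : convex_cone (epi_sigma b).
Proof.
have [N0 ND NZ] := Nbeta_cone b.
rewrite /epi_sigma; split=> /=.
- rewrite unpack0; split=> //= x _.
  by rewrite Amul0 oppr0 -(scale0r 0) dotpZl mul0r.
- move=> y z; rewrite -[y]unpackK -[z]unpackK -packD !packK /=.
  move=> [Ny yX] [Nz zX]; split; first exact: ND.
  by move=> x Xx; rewrite AmulD opprD dotpDl lerD ?yX ?zX.
- move=> a y a0; rewrite -[y]unpackK -packZ !packK /=.
  move=> [Ny yX]; split; first exact: NZ.
  by move=> x Xx; rewrite AmulZ -scalerN dotpZl ler_wpM2l ?yX.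
Qed.

Lemma epi_sigma_closed b : closed (epi_sigma b).
Proof.
have lc : forall v : 'rV[R]_(m + 1), closed [set z | 0 <= dotp v z].
  by move=> v; apply: closed_fun_ge; exact: dotp_continuous.
have -> : epi_sigma b =
  (\bigcap_(i in [set i | i != b]) [set z | 0 <= dotp (pack (delta_mx 0 i, 0)) z]) `&`
  [set z | dotp (pack (const_mx 1, 0)) z = 0] `&`
  (\bigcap_(x in X) [set z | 0 <= dotp (pack (\row_i dotp (alpha i) x, 1)) z]).
  apply/seteqP; split=> z; rewrite /epi_sigma /Nbeta /=.
    move=> [[z0 z1] zX]; split; first split.
    - by move=> i /= ib; rewrite -[z]unpackK dotp_pack /= mul0r addr0 dotpC dotp_delta z0.
    - rewrite -[z]unpackK dotp_pack /= mul0r addr0 -[RHS]z1 /dotp; apply: eq_bigr => i _.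
      by rewrite mxE mul1r.
    - move=> x Xx /=; rewrite -[z]unpackK dotp_pack /= mul1r.
      by have := zX _ Xx; rewrite dotpNl -dotp_row -subr_ge0 opprK addrC.
  move=> [[z0 z1] zX]; split; first split.
  - by move=> i /z0 /=; rewrite -{1}[z]unpackK dotp_pack /= mul0r addr0 dotpC dotp_delta.
  - move: z1; rewrite -{1}[z]unpackK dotp_pack /= mul0r addr0 /dotp => z1.
    by rewrite -[RHS]z1; apply: eq_bigr => i _; rewrite [const_mx _ _ _]mxE mul1r.
  - move=> x /zX /=; rewrite -{1}[z]unpackK dotp_pack /= mul1r => zx.
    by rewrite dotpNl -dotp_row -subr_ge0 opprK addrC.
apply: closedI; first apply: closedI.
- by apply: closed_bigI => i _.
- by apply: closed_fun_eq; exact: dotp_continuous.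
- by apply: closed_bigI => x _.
Qed.

Definition epi_sum : set 'rV[R]_(m + 1) := setsum epi_sigma.

Lemma epi_sum_cone : convex_cone epi_sum.
Proof.
split.
- exists (fun=> 0); split; last by rewrite big1.
  by move=> b; have [] := epi_sigma_cone b.
- move=> _ _ [y [Ey ->]] [z [Ez ->]]; exists (fun b => y b + z b); split; last first.
    by rewrite big_split.
  by move=> b; have [_ + _] := epi_sigma_cone b; apply.
- move=> a _ a0 [y [Ey ->]]; exists (fun b => a *: y b); split; last by rewrite scaler_sumr.
  by move=> b; have [_ _] := epi_sigma_cone b; apply.
Qed.

Lemma epi_sigma_sub_sum b : epi_sigma b `<=` epi_sum.
Proof.
move=> z Ez; exists (fun b' => if b' == b then z else 0); split; last first.
  by rewrite -big_mkcond big_pred1_eq.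
by move=> b'; case: eqP => [->//|_]; have [] := epi_sigma_cone b'.
Qed.

Hypotheses (X0 : X !=set0) (Xind : exp_lin_indep X alpha).

Lemma sigmaX_gtNy y : (-oo < sigmaX X y)%E.
Proof.
have [x Xx] := X0; apply: lt_le_trans (ltNyr (dotp y x)) _.
by apply: ereal_sup_ubound; exists x.
Qed.

Lemma sigmaX_fineK y : (sigmaX X y < +oo)%E -> (fine (sigmaX X y))%:E = sigmaX X y.
Proof. by move=> yoo; rewrite fineK// fin_numE -ltey -ltNye sigmaX_gtNy. Qed.

(* All the inequalities -(A nu_b)^T x <= t_b are tight, so each
   sum_i nu_b(i) exp(alpha_i^T (x - x0)) is nonnegative by e^s >= 1 + s; since
   these add up to 0 they vanish on X, and linear independence applies. *)
Lemma epi_sigma_sum0 (z : 'I_m -> 'rV[R]_(m + 1)) :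
  (forall b, epi_sigma b (z b)) -> \sum_b z b = 0 -> forall b, z b = 0.
Proof.
move=> Ez sz0.
pose nu b := (unpack (z b)).1; pose t b := (unpack (z b)).2.
have zE b : z b = pack (nu b, t b) by rewrite -[z b]unpackK.
have : unpack (\sum_b z b) = 0 by rewrite sz0 unpack0.
rewrite unpack_sum => sz.
have snu : \sum_b nu b = 0.
  by move: (congr1 fst sz); rewrite (big_morph fst (id1 := 0) (op1 := +%R)).
have st : \sum_b t b = 0.
  by move: (congr1 snd sz); rewrite (big_morph snd (id1 := 0) (op1 := +%R)).
have tight x b : X x -> dotp (Amul alpha (nu b)) x = - t b.
  move=> Xx.
  have : \sum_b (t b + dotp (Amul alpha (nu b)) x) = 0.
    rewrite big_split /= st add0r -dotp_suml.
    have -> : \sum_b Amul alpha (nu b) = Amul alpha (\sum_b nu b).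
      by rewrite (big_morph _ AmulD Amul0).
    by rewrite snu Amul0 dotpC dotp0r.
  have ge0 c : 0 <= t c + dotp (Amul alpha (nu c)) x.
    by have [_ /(_ _ Xx)] := Ez c; rewrite dotpNl -subr_ge0 opprK.
  move/eqP; rewrite psumr_eq0// => /allP/(_ b (mem_index_enum _)) /=.
  by rewrite addr_eq0 => /eqP ->; rewrite opprK.
have [x0 Xx0] := X0.
pose P b x := \sum_i nu b 0 i * expR (dotp (alpha i) (x - x0)).
have P_ge0 x b : X x -> 0 <= P b x.
  move=> Xx; have [[nu_ge0 snub] _] := Ez b.
  pose s i := dotp (alpha i) (x - x0).
  have sns : \sum_i nu b 0 i * s i = 0.
    by rewrite -dotp_Amul dotpBr !tight// subrr.
  (* Factoring out exp(s_b) puts exponent 0 at index b, where the coefficient may be negative: there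
     e^s >= 1 + s is an equality, and elsewhere it is multiplied by a nonnegative coefficient. *)
  have -> : P b x = expR (s b) * \sum_i nu b 0 i * expR (s i - s b).
    rewrite big_distrr; apply: eq_bigr => i _ /=.
    by rewrite mulrCA -expRD addrCA subrr addr0.
  apply: mulr_ge0; first exact: expR_ge0.
  have lin0 : \sum_i nu b 0 i * (1 + (s i - s b)) = 0.
    under eq_bigr do rewrite mulrDr mulr1 mulrBr.
    rewrite big_split /= sumrB sns -big_distrl /= -/(nu b) in snub *.
    by rewrite snub mul0r subr0 addr0.
  rewrite -[leLHS]lin0; apply: ler_sum => i _; have [->|ib] := eqVneq i b.
    by rewrite subrr expR0 addr0.
  by rewrite ler_wpM2l ?nu_ge0// expR_ge1Dx.
have P0 x b : X x -> P b x = 0.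
  move=> Xx; have : \sum_b P b x = 0.
    rewrite exchange_big big1// => i _; rewrite -big_distrl /=.
    by move/rowP/(_ i): snu; rewrite summxE mxE => ->; rewrite mul0r.
  move/eqP; rewrite psumr_eq0; last by move=> c _; exact: P_ge0.
  by move=> /allP/(_ b (mem_index_enum _)) /= /eqP.
move=> b.
have nub0 : nu b = 0.
  apply/rowP => i; have /rowP/(_ i) : \row_i (nu b 0 i * expR (- dotp (alpha i) x0)) = 0.
    apply: Xind => x Xx; rewrite -[RHS](P0 x b Xx); apply: eq_bigr => j _.
    by rewrite mxE -mulrA -expRD dotpBr addrC.
  by rewrite !mxE => /eqP; rewrite mulf_eq0 (gt_eqF (expR_gt0 _)) orbF => /eqP.
have := tight _ b Xx0; rewrite nub0 Amul0 dotpC dotp0r => /esym/eqP.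
by rewrite oppr_eq0 zE nub0 => /eqP ->; exact: pack0.
Qed.

Lemma epi_sum_closed : closed epi_sum.
Proof.
apply: closed_setsum => [b|b|]; [exact: epi_sigma_closed|exact: epi_sigma_cone|].
exact: epi_sigma_sum0.
Qed.

(** A nonzero nu in N_b has a negative entry at b, so - nu is not in N_b; once nu = 0, the height
    and its opposite are both nonnegative. *)
Lemma epi_sigma_pointed b z : epi_sigma b z -> epi_sigma b (- z) -> z = 0.
Proof.
rewrite -[z]unpackK -scaleN1r -packZ; case: (unpack z) => nu t.
rewrite /epi_sigma /= !packK /= => -[N E] [N' E'].
have nu0 : nu = 0.
  apply/eqP/negPn/negP => nu0; have := Nbeta_neg N nu0.
  have N'0 : -1 *: nu != 0 by rewrite scaler_eq0 oppr_eq0 oner_eq0.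
  by have := Nbeta_neg N' N'0; rewrite mxE mulN1r oppr_lt0 => /ltW; rewrite leNgt => /negPf ->.
have [x Xx] := X0; move: (E _ Xx) (E' _ Xx); rewrite nu0 scaler0 Amul0 oppr0 dotpC dotp0r.
rewrite [_ *: _]mulN1r oppr_ge0 => t0 t1.
have -> : t = 0 by apply/eqP; rewrite eq_le t0 t1.
exact: pack0.
Qed.

(** Adding decompositions of z and - z index by index gives elements of the epigraphs with sum 0,
    which vanish; this leaves the pointedness of each single epigraph. *)
Lemma epi_sum_pointed z : epi_sum z -> epi_sum (- z) -> z = 0.
Proof.
move=> [y [Ey zy]] [y' [Ey' zy']].
have yy' : forall b, y b + y' b = 0.
  apply: epi_sigma_sum0; last by rewrite big_split /= -zy -zy' subrr.
  by move=> b; have [_ + _] := epi_sigma_cone b; apply.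
rewrite zy big1// => b _; apply: (@epi_sigma_pointed b) => //.
by have /eqP := yy' b; rewrite addrC addr_eq0 => /eqP <-.
Qed.

End Circuits.

(** * Extreme rays of the sum of epigraphs and reduced circuits *)

Lemma convex_cone_sum (R : realType) (V : lmodType R) (K : set V) k
    (w : 'I_k -> R) (p : 'I_k -> V) : convex_cone K ->
  (forall j, 0 <= w j) -> (forall j, K (p j)) -> K (\sum_j w j *: p j).
Proof.
move=> [K0 KD KZ] w0 Kp; apply: big_ind => [//|x y|j _]; first exact: KD.
exact: KZ.
Qed.

Section ExtremeRays.
Context {R : realType} {n m : nat}.
Variables (X : set 'rV[R]_n) (alpha : 'I_m -> 'rV[R]_n).
Hypotheses (X0 : X !=set0) (Xind : exp_lin_indep X alpha).

Local Notation sigma nu := (sigmaX X (- Amul alpha nu)).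
Local Notation epi := (epi_sigma X alpha).
Local Notation epis := (epi_sum X alpha).

Lemma Xcircuit_epi b lam : Xcircuit X alpha b lam -> epi b (pack (phi X alpha lam)).
Proof. by move=> [Nlam _ soo _]; apply/pack_epi; split; rewrite // sigmaX_fineK. Qed.

(** This inclusion lets extremality pass from the sum of epigraphs to the circuit graph. A nonempty
    index set provides an epigraph that contains (0, 1). *)
Lemma circuit_graph_epi p : (0 < m)%N -> circuit_graph X alpha p -> epis (pack p).
Proof.
move=> m0 [k [w [q [w0 Gq ->]]]]; rewrite pack_sum.
under eq_bigr do rewrite packZ.
apply: convex_cone_sum => // [|j]; first exact: epi_sum_cone.
case: (Gq j) => [[lam [b [lamb _]] <-]|->].
  by apply: (@epi_sigma_sub_sum _ _ _ _ _ b); exact: Xcircuit_epi.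
apply: (@epi_sigma_sub_sum _ _ _ _ _ (Ordinal m0)); apply/pack_epi; split.
  by have [] := Nbeta_cone (R := R) (Ordinal m0).
by apply/sigmaX_le => x _; rewrite Amul0 oppr0 dotpC dotp0r.
Qed.

Section ExtremeVertex.
Variables (b : 'I_m) (lam : 'rV[R]_m) (t : R).
Hypotheses (lamb : lam 0 b = -1) (Elam : epi b (pack (lam, t))).
Hypothesis ext : forall v w s, epis v -> epis w -> v + w = s *: pack (lam, t) ->
  exists2 a, 0 <= a & v = a *: pack (lam, t).

Lemma extreme_height : t = fine (sigma lam).
Proof.
have [Nlam st] := (pack_epi _ _ _ _ _).1 Elam.
have soo : (sigma lam < +oo)%E by exact: le_lt_trans st (ltry _).
have sE := sigmaX_fineK X0 soo.
set s := fine _ in sE *.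
have E1 : epi b (pack (lam, s)) by apply/pack_epi; rewrite sE.
have E2 : epi b (pack (0, t - s)).
  apply/pack_epi; split; first by have [] := Nbeta_cone (R := R) b.
  apply/sigmaX_le => x _; rewrite Amul0 oppr0 dotpC dotp0r.
  by rewrite subr_ge0 -lee_fin sE.
have [|a a0] := @ext _ _ 1 (epi_sigma_sub_sum E1) (epi_sigma_sub_sum E2).
  by rewrite -packD scale1r; congr pack; congr pair; rewrite /= ?addr0// addrC subrK.
rewrite -packZ => /(can_inj packK)[] /rowP/(_ b); rewrite mxE lamb mulrN1.
by move=> /oppr_inj <- ->; rewrite [1 *: _]mul1r.
Qed.

(** A decomposition of lam along which sigma is affine lifts to a decomposition of (lam, t) into
    points of the epigraph; extremality makes both parts multiples of (lam, t), so nu1 and nu2 are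
    proportional. *)
Lemma extreme_circuit : Xcircuit X alpha b lam.
Proof.
have [Nlam st] := (pack_epi _ _ _ _ _).1 Elam.
have soo : (sigma lam < +oo)%E by exact: le_lt_trans st (ltry _).
split => //.
  by apply/eqP => /rowP/(_ b)/eqP; rewrite lamb mxE oppr_eq0 oner_eq0.
move=> [nu1 [nu2 [s [[N1 N2] nprop /andP[s0 s1] lamE aff]]]].
have s01 : 0 <= s <= 1 by rewrite !ltW.
have s1' : 0 < 1 - s by rewrite subr_gt0.
have {aff} := aff _ s01; rewrite -lamE => aff.
(* Neither value is -oo and both weights are positive, so an infinite value at an endpoint would
   make sigma infinite at lam. *)
have [r1 [r2 [e1 e2]]] : exists r1 r2, sigma nu1 = r1%:E /\ sigma nu2 = r2%:E.
  move: (sigmaX_gtNy X0 (- Amul alpha nu1)) (sigmaX_gtNy X0 (- Amul alpha nu2)) soo.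
  rewrite aff.
  case: (sigma nu1) => [r1| |] // _; case: (sigma nu2) => [r2| |] // _.
  - by exists r1, r2.
  - by rewrite gt0_muley ?lte_fin// -EFinM addey.
  - by rewrite gt0_muley ?lte_fin// -EFinM addye.
  - by rewrite !gt0_muley ?lte_fin.
have tE : t = s * r1 + (1 - s) * r2 by rewrite extreme_height aff e1 e2.
have E1 : epi b (pack (s *: (nu1, r1))).
  have [_ _ EZ] := epi_sigma_cone X alpha b; rewrite packZ; apply: EZ; first exact: ltW.
  by apply/pack_epi; rewrite e1.
have E2 : epi b (pack ((1 - s) *: (nu2, r2))).
  have [_ _ EZ] := epi_sigma_cone X alpha b; rewrite packZ; apply: EZ; first exact: ltW.
  by apply/pack_epi; rewrite e2.
have E12 : pack (s *: (nu1, r1)) + pack ((1 - s) *: (nu2, r2)) = 1 *: pack (lam, t).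
  by rewrite -packD scale1r lamE tE.
have [a a0] := ext (epi_sigma_sub_sum E1) (epi_sigma_sub_sum E2) E12.
rewrite -packZ => /(can_inj packK)[nu1E _].
have [a' a'0] := ext (epi_sigma_sub_sum E2) (epi_sigma_sub_sum E1)
  (etrans (addrC _ _) E12).
rewrite -packZ => /(can_inj packK)[nu2E _].
apply: nprop; have [a00|an0] := eqVneq a 0.
  left; exists 0; rewrite scale0r; apply/eqP.
  by move/eqP: nu1E; rewrite a00 scale0r scaler_eq0 gt_eqF.
right; exists ((1 - s)^-1 * (a' * (a^-1 * s))).
by rewrite -!scalerA nu1E (scalerA a^-1) mulVf// scale1r -nu2E scalerA mulVf ?scale1r// gt_eqF.
Qed.

Lemma extreme_Lambda_star : (0 < m)%N -> Lambda_star X alpha lam.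
Proof.
move=> m0; have Cb := extreme_circuit.
have Llam : Lambda X alpha lam by exists b.
split => //; split.
- apply/eqP => -[/rowP/(_ b)/eqP]; by rewrite lamb mxE oppr_eq0 oner_eq0.
- move=> _ [a /= a0 <-]; exists 1%N, (fun=> a), (fun=> phi X alpha lam); split => //.
    by move=> _; left; exists lam.
  by rewrite big_ord1.
- have phiE : phi X alpha lam = (lam, t) by rewrite /phi -extreme_height.
  have half v w : circuit_graph X alpha v -> circuit_graph X alpha w ->
      [set a *: phi X alpha lam | a in [set a : R | 0 <= a]] (v + w) ->
      [set a *: phi X alpha lam | a in [set a : R | 0 <= a]] v.
    rewrite phiE => /(circuit_graph_epi m0) Gv /(circuit_graph_epi m0) Gw [s /= s0 vwE].
    have [|a a0] := ext (s := s) Gv Gw; first by rewrite -packD -vwE packZ.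
    by rewrite -packZ => /(can_inj packK) ->; exists a.
  move=> v w Gv Gw vw; split; first exact: half vw.
  by apply: (half w v) => //; rewrite addrC.
Qed.

End ExtremeVertex.

(* A functional (y, 1) that is negative somewhere on the sum of the epigraphs
   is negative on an extreme ray of it, and such a ray comes from a single
   epigraph, hence from a reduced circuit. *)
Lemma epi_sum_dual (y : 'rV[R]_m) : (0 < m)%N ->
  (forall lam, Lambda_star X alpha lam -> 0 <= dotp y lam + fine (sigma lam)) ->
  forall z, epis z -> 0 <= dotp (pack (y, 1)) z.
Proof.
move=> m0 yL z Ez; rewrite leNgt; apply/negP => yz.
have [u [[x [Ex uE]] yu ext]] := extreme_ray_lt0 (epi_sum_closed X0 Xind)
  (epi_sum_cone X alpha) (epi_sum_pointed X0 Xind) Ez yz.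
have [b xb0] : exists b, x b != 0.
  apply/existsP; rewrite -negb_forall; apply/negP => /forallP x0.
  by move: yu; rewrite uE big1 ?dotp0r ?ltxx// => b _; apply/eqP/x0.
(* Split u into x b and the remaining summands: by extremality x b already spans the ray. *)
have [a a0 xbE] : exists2 a, 0 <= a & x b = a *: u.
  apply: (ext _ (\sum_(c | c != b) x c) 1).
  - exact: epi_sigma_sub_sum (Ex b).
  - rewrite big_mkcond; exists (fun c => if c != b then x c else 0); split => // c.
    by case: ifP => // _; have [] := epi_sigma_cone X alpha c.
  - by rewrite scale1r uE [RHS](bigD1 b).
have {}a0 : 0 < a.
  by rewrite lt_neqAle a0 andbT; apply: contraNneq xb0 => a0'; rewrite xbE -a0' scale0r.
have uxb : u = a^-1 *: x b by rewrite xbE scalerA mulVf ?scale1r// gt_eqF.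
have [_ _ EZ] := epi_sigma_cone X alpha b.
have Eu : epi b u by rewrite uxb; apply: EZ; rewrite // invr_ge0 ltW.
move: Eu yu ext; rewrite -[u]unpackK; case: (unpack u) => nu t Eu yu ext.
have [Nnu st] := (pack_epi _ _ _ _ _).1 Eu.
rewrite dotp_pack /= mul1r in yu.
have nu0 : nu != 0.
  apply: contraTneq yu => nu0; rewrite -leNgt nu0 dotp0r add0r.
  have [x0 Xx0] := X0; move/sigmaX_le/(_ _ Xx0): st.
  by rewrite nu0 Amul0 oppr0 dotpC dotp0r.
have nub := Nbeta_neg Nnu nu0.
(* Rescaling by 1 / k brings the negative entry to -1, as membership in [Lambda] requires. *)
pose k := - nu 0 b; have k0 : 0 < k by rewrite oppr_gt0.
pose lam := k^-1 *: nu; pose t' := k^-1 * t.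
have nuE : pack (nu, t) = k *: pack (lam, t').
  rewrite -packZ; congr pack; congr pair; first by rewrite /lam scalerA divff ?scale1r// gt_eqF.
  by rewrite /t' [RHS]mulrA divff ?mul1r// gt_eqF.
have lamb : lam 0 b = -1.
  by rewrite mxE /k invrN mulNr mulVf// lt_eqF.
have Elam : epi b (pack (lam, t')).
  have -> : pack (lam, t') = k^-1 *: pack (nu, t).
    by rewrite nuE scalerA mulVf ?scale1r// gt_eqF.
  by apply: EZ => //; rewrite invr_ge0 ltW.
have ext' v w s : epis v -> epis w -> v + w = s *: pack (lam, t') ->
    exists2 a, 0 <= a & v = a *: pack (lam, t').
  move=> Ev Ew vw; have [|c c0 ->] := ext v w (s / k) Ev Ew.
    by rewrite vw nuE scalerA divfK// gt_eqF.
  by exists (c * k); rewrite ?mulr_ge0 ?(ltW k0)// nuE scalerA.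
have := yL _ (extreme_Lambda_star lamb Elam ext' m0).
rewrite -(extreme_height lamb Elam ext') /lam /t' dotpZr -mulrDr.
by rewrite pmulr_rge0 ?invr_gt0// leNgt yu.
Qed.

(** Without reduced circuits the hypothesis of [epi_sum_dual] is vacuous, so every functional (y, 1)
    would be nonnegative at phi_lam. *)
Lemma Lambda_star_neq0 : (0 < m)%N -> Lambda X alpha !=set0 -> Lambda_star X alpha !=set0.
Proof.
move=> m0 [lam [b [Clam lamb]]]; apply/set0P/negP => /eqP L0.
set s := fine (sigma lam).
(* For this y the value at phi_lam is - (|s| + 1) (lam . lam) + s, which is at most -1 because lam .
   lam >= 1. *)
have := epi_sum_dual (y := - (`|s| + 1) *: lam) m0 _ (epi_sigma_sub_sum (Xcircuit_epi Clam)).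
rewrite dotp_pack /= mul1r dotpZl -/s => /(_ _)/wrap[lam' Llam'|].
  by move: Llam'; rewrite L0.
have : 1 <= dotp lam lam.
  rewrite /dotp (bigD1 b)//= lamb mulrNN mulr1 lerDl.
  by apply: sumr_ge0 => i _; rewrite -expr2 sqr_ge0.
have := ler_norm s; have := normr_ge0 s; nra.
Qed.

End ExtremeRays.

(** * The weighted inequality of arithmetic and geometric means *)

(** A zero u_i kills the product. Otherwise let G be the weighted mean of the logarithms and average
    e^s >= 1 + s at s = ln u_i - G: the linear terms cancel. *)
Lemma weighted_AMGM (R : realType) (I : finType) (P : pred I) (w u : I -> R) :
  (forall i, P i -> 0 < w i) -> (forall i, P i -> 0 <= u i) ->
  \sum_(i | P i) w i = 1 ->
  \prod_(i | P i) u i `^ w i <= \sum_(i | P i) w i * u i.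
Proof.
move=> w0 u0 sw.
have [/existsP[i /andP[Pi /eqP ui]]|/negP un0] := boolP [exists i, P i && (u i == 0)].
  rewrite (bigD1 i)//= ui powR0 ?gt_eqF ?w0// mul0r.
  by apply: sumr_ge0 => j Pj; rewrite mulr_ge0 ?u0// ltW// w0.
have {}u0 i : P i -> 0 < u i.
  move=> Pi; rewrite lt_neqAle u0// andbT; apply/eqP => ui; apply: un0.
  by apply/existsP; exists i; rewrite Pi -ui eqxx.
set G := \sum_(i | P i) w i * ln (u i).
have -> : \prod_(i | P i) u i `^ w i = expR G.
  by rewrite expR_sum; apply: eq_bigr => i Pi; rewrite /powR gt_eqF ?u0.
have -> : expR G = \sum_(i | P i) w i * (expR G * (1 + (ln (u i) - G))).
  under eq_bigr do rewrite mulrCA.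
  rewrite -big_distrr /= -[LHS]mulr1; congr (_ * _).
  under eq_bigr do rewrite mulrDr mulr1 mulrBr.
  by rewrite big_split /= sumrB sw -big_distrl /= sw mul1r subrr addr0.
apply: ler_sum => i Pi; rewrite ler_pM2l ?w0// -[leRHS](lnK (u0 i Pi)).
rewrite -[in leRHS](subrK G (ln (u i))) expRD mulrC ler_pM2r ?expR_gt0//.
exact: expR_ge1Dx.
Qed.

(** * AGE and SAGE cones, and their duality with the epigraphs *)

Section AGE.
Context {R : realType} {n m : nat}.
Variables (X : set 'rV[R]_n) (alpha : 'I_m -> 'rV[R]_n).

Local Notation sigma nu := (sigmaX X (- Amul alpha nu)).
Local Notation epi := (epi_sigma X alpha).
Local Notation epis := (epi_sum X alpha).
Local Notation SAGE := (SAGE_cone X alpha).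

Definition exp_row (x : 'rV[R]_n) : 'rV[R]_m := \row_i expR (dotp (alpha i) x).

Lemma signomialE c x : signomial alpha c x = dotp (exp_row x) c.
Proof. by apply: eq_bigr => i _; rewrite mxE mulrC. Qed.

Lemma AGE_cone_convex_cone b : convex_cone (AGE_cone X alpha b).
Proof.
split=> [|c d [c0 cX] [d0 dX]|a c a0 [c0 cX]].
- by split=> [i _|x _]; rewrite ?mxE// signomialE dotp0r.
- by split=> [i ib|x Xx]; [rewrite mxE addr_ge0 ?c0 ?d0|
    rewrite signomialE dotpDr -!signomialE addr_ge0 ?cX ?dX].
- by split=> [i ib|x Xx]; [rewrite mxE mulr_ge0 ?c0|
    rewrite signomialE dotpZr -signomialE mulr_ge0 ?cX].
Qed.

Lemma AGE_cone_closed b : closed (AGE_cone X alpha b).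
Proof.
have -> : AGE_cone X alpha b =
    (\bigcap_(i in [set i | i != b]) [set c | 0 <= dotp (delta_mx 0 i) c]) `&`
    (\bigcap_(x in X) [set c | 0 <= dotp (exp_row x) c]).
  apply/seteqP; split=> c [h1 h2]; split.
  - by move=> i /h1; rewrite /= dotpC dotp_delta.
  - by move=> x /h2; rewrite signomialE.
  - by move=> i /h1; rewrite /= dotpC dotp_delta.
  - by move=> x /h2; rewrite signomialE.
by apply: closedI; apply: closed_bigI => i _; apply: closed_fun_ge; exact: dotp_continuous.
Qed.

(** AGE signomials adding up to 0 are nonnegative on X, so each vanishes on X and has zero
    coefficients by linear independence; [closed_setsum] applies. *)
Lemma SAGE_cone_closed : exp_lin_indep X alpha -> closed SAGE.
Proof.
move=> Xind; apply: (@closed_setsum _ _ _ (AGE_cone X alpha)) => [b|b|f Ef sf b].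
- exact: AGE_cone_closed.
- exact: AGE_cone_convex_cone.
apply: Xind => x Xx; rewrite -/(signomial alpha (f b) x).
have : \sum_c signomial alpha (f c) x = 0.
  by under eq_bigr do rewrite signomialE; rewrite -dotp_sumr sf dotp0r.
move/eqP; rewrite psumr_eq0; last by move=> c _; have [_] := Ef c; apply.
by move=> /allP/(_ b (mem_index_enum _)) /= /eqP.
Qed.

Lemma SAGE_cone_convex_cone : convex_cone SAGE.
Proof.
split.
- exists (fun=> 0); split; last by rewrite big1.
  by move=> b; have [] := AGE_cone_convex_cone b.
- move=> _ _ [f [Ef ->]] [g [Eg ->]]; exists (fun b => f b + g b); split; last first.
    by rewrite big_split.
  by move=> b; have [_ + _] := AGE_cone_convex_cone b; apply.
- move=> a _ a0 [f [Ef ->]]; exists (fun b => a *: f b); split; last by rewrite scaler_sumr.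
  by move=> b; have [_ _] := AGE_cone_convex_cone b; apply.
Qed.

Lemma AGE_cone_sub_SAGE b : AGE_cone X alpha b `<=` SAGE.
Proof.
move=> z Ez; exists (fun b' => if b' == b then z else 0); split; last first.
  by rewrite -big_mkcond big_pred1_eq.
by move=> b'; case: eqP => [->//|_]; have [] := AGE_cone_convex_cone b'.
Qed.

Lemma orthant_sub_AGE b : @orthant R m `<=` AGE_cone X alpha b.
Proof.
move=> c c0; split=> [i _|x _]; first exact: c0.
by apply: sumr_ge0 => i _; rewrite mulr_ge0 ?expR_ge0.
Qed.

Lemma SAGE_signomial_ge0 c x : SAGE c -> X x -> 0 <= dotp (exp_row x) c.
Proof.
move=> [f [Ef ->]] Xx; rewrite dotp_sumr; apply: sumr_ge0 => b _.
by rewrite -signomialE; have [_] := Ef b; apply.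
Qed.

(* If no x in X satisfied y_i - y_b >= (alpha_i - alpha_b)^T x - e for all i,
   separating 0 from the convex set of vectors lying below some
   ((y_i - y_b) - (alpha_i - alpha_b)^T x)_i would produce nu in N_b with
   y . nu + sigma(nu) < 0. *)
Lemma epi_dual_approx y b (e : R) : X !=set0 -> convex_setR X ->
  (forall z, epi b z -> 0 <= dotp (pack (y, 1)) z) -> 0 < e ->
  exists2 x, X x & forall i, - e <= (y 0 i - y 0 b) - dotp (alpha i - alpha b) x.
Proof.
move=> [x0 Xx0] Xcvx yE e0.
pose d x i := (y 0 i - y 0 b) - dotp (alpha i - alpha b) x.
pose D := [set z : 'rV[R]_m | exists2 x, X x & forall i, z 0 i <= d x i].
have Dd x : X x -> D (\row_i d x i) by exists x => // i; rewrite mxE.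
have [/(_ _ (nbhsx_ballx 0 e e0))[z [[x Xx zd] [_ ze]]]|D0] := pselect (closure D 0).
  exists x => // i; apply: le_trans (zd i); apply: ltW.
  have := ze 0 i; rewrite mxE /ball/= sub0r normrN ltr_norml.
  by case/andP.
have Dcvx : convex_setR D.
  move=> z z' s [x Xx zx] [x' Xx' zx'] s01; exists (s *: x + (1 - s) *: x').
    exact: Xcvx.
  move=> i; have -> : d (s *: x + (1 - s) *: x') i = s * d x i + (1 - s) * d x' i.
    by rewrite /d dotpDr !dotpZr; ring.
  by case/andP: s01 => s0 s1; rewrite !mxE lerD// ler_wpM2l// subr_ge0.
have [w [w0 wD]] := separation (ex_intro _ _ (Dd _ Xx0)) Dcvx D0.
have {}wD z : D z -> dotp w w <= dotp w z by move=> /wD; rewrite dotp0r add0r.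
have ww0 : 0 < dotp w w.
  by rewrite lt_neqAle dotpxx_ge0 andbT eq_sym; apply: contra_neq w0; exact: dotpxx_eq0.
(* [D] is closed under decreasing any coordinate, so w, being bounded below on it, has no positive
   entry. *)
have w_le0 i : w 0 i <= 0.
  rewrite -oppr_ge0.
  apply: (@ge0_of_scaled_bound _ (dotp w w - dotp w (\row_j d x0 j))) => a a0.
  rewrite lerBlDl -dotp_delta mulrN -dotpZr -dotpBr; apply: wD.
  by exists x0 => // j; rewrite !mxE lerBlDr lerDl mulr_ge0.
(* The entry at b is set to make the sum zero; this does not affect the pairing with [d x], which
   vanishes at b. *)
pose nu : 'rV[R]_m := \row_i (if i == b then \sum_(j | j != b) w 0 j else - w 0 i).
have Nnu : Nbeta b nu.
  split=> [i ib|]; first by rewrite mxE (negPf ib) oppr_ge0.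
  rewrite (bigD1 b)//= mxE eqxx -big_split big1//= => i ib.
  by rewrite mxE (negPf ib) subrr.
(* With this height (y, 1) takes the value - w . w < 0. *)
have Enu : epi b (pack (nu, - dotp w w - dotp y nu)).
  apply/pack_epi; split => //; apply/sigmaX_le => x Xx.
  have nud : \sum_i nu 0 i * d x i = dotp y nu - dotp (Amul alpha nu) x.
    have -> : dotp y nu = \sum_i nu 0 i * y 0 i.
      by apply: eq_bigr => i _; rewrite mulrC.
    have nu0 : \sum_i nu 0 i * (dotp (alpha b) x - y 0 b) = 0.
      by rewrite -big_distrl; case: Nnu => _ /= ->; rewrite mul0r.
    rewrite dotp_Amul -sumrB -[RHS]addr0 -[X in _ + X]nu0 -big_split.
    by apply: eq_bigr => i _ /=; rewrite /d dotpBl; ring.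
  have : \sum_i nu 0 i * d x i = - dotp w (\row_i d x i).
    rewrite /dotp -sumrN; apply: eq_bigr => i _; rewrite !mxE.
    case: eqP => [->|_]; last by rewrite mulNr.
    by rewrite /d !subrr dotpC dotp0r subr0 !mulr0 oppr0.
  have := wD _ (Dd _ Xx); rewrite nud dotpNl; lra.
have := yE _ Enu; rewrite dotp_pack /= mul1r; lra.
Qed.

(** Up to a small error, (exp(y_i))_i dominates a positive multiple of (exp(alpha_i^T x))_i for some
    x in X, with near equality at b, so nonnegativity of the signomial at x carries over. Tolerance
    1 / a gives S >= - k / a for every a > 0. *)
Lemma AGE_dual y b c : X !=set0 -> convex_setR X ->
  (forall z, epi b z -> 0 <= dotp (pack (y, 1)) z) -> AGE_cone X alpha b c ->
  0 <= \sum_i c 0 i * expR (y 0 i).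
Proof.
move=> X0 Xcvx yE [c0 cX]; set S := \sum_i _.
pose k := `|c 0 b * expR (y 0 b)|.
apply: (@ge0_of_scaled_bound _ (- k)) => a a0.
have [<-|an0] := eqVneq 0 a; first by rewrite mul0r oppr_le0 normr_ge0.
have {an0}a0 : 0 < a by rewrite lt_neqAle an0.
have ia0 : 0 < a^-1 by rewrite invr_gt0.
have [x Xx xe] := epi_dual_approx X0 Xcvx yE ia0.
pose q := expR (- a^-1).
have q1 : q <= 1 by rewrite /q -expR0 ler_expR oppr_le0 ltW.
have q2 : 1 - q <= a^-1.
  by have := expR_ge1Dx (- a^-1); rewrite -/q; lra.
pose E := expR (y 0 b - dotp (alpha b) x).
have Eb : E * expR (dotp (alpha b) x) = expR (y 0 b) by rewrite -expRD subrK.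
(* For i != b the choice of x gives exp(y_i) >= q E exp(alpha_i^T x). At b the exact value is E
   exp(alpha_b^T x), and the first term corrects for the factor q. *)
have : c 0 b * expR (y 0 b) * (1 - q) + q * E * signomial alpha c x <= S.
  have -> : c 0 b * expR (y 0 b) * (1 - q) + q * E * signomial alpha c x =
      c 0 b * expR (y 0 b) + \sum_(i | i != b) c 0 i * (q * E * expR (dotp (alpha i) x)).
    under [in RHS]eq_bigr do rewrite mulrCA.
    by rewrite -big_distrr /= /signomial (bigD1 b)//= -Eb; ring.
  rewrite /S [leRHS](bigD1 b)//= lerD2l; apply: ler_sum => i ib; rewrite ler_wpM2l ?c0//.
  rewrite -!expRD ler_expR; have := xe i; rewrite dotpBl; lra.
have := cX _ Xx; set f := signomial _ _ _ => f0.
have qE0 : 0 <= q * E * f by rewrite !mulr_ge0 ?expR_ge0.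
have kq : - (k * a^-1) <= c 0 b * expR (y 0 b) * (1 - q).
  rewrite lerNl (le_trans (ler_norm _))// normrN normrM ler_wpM2l ?normr_ge0//.
  by rewrite ger0_norm// subr_ge0.
move=> kS; have : - (k * a^-1) <= S by lra.
by rewrite -(ler_pM2l a0) mulrN mulrCA divff ?mulr1// gt_eqF.
Qed.

(** * Cones witnessed by a single circuit *)

Section Witnessed.
Variables (b : 'I_m) (lam : 'rV[R]_m).
Hypotheses (Clam : Xcircuit X alpha b lam) (lamb : lam 0 b = -1).

Let lam_ge0 i : i != b -> 0 <= lam 0 i.
Proof. by case: Clam => -[+ _] _ _ _; apply. Qed.

Let lam_neg i : lam 0 i < 0 -> i = b.
Proof. by move=> li; apply/eqP; apply: contraTT li => /lam_ge0; rewrite leNgt. Qed.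

Let lam_neqb i : 0 < lam 0 i -> i != b.
Proof. by apply: contraTneq => ->; rewrite lamb -leNgt lerN10. Qed.

(** The term of the full sum at b is - g b, because lam_b = -1. *)
Lemma sum_lambda_pos (g : 'I_m -> R) :
  \sum_(i | 0 < lam 0 i) lam 0 i * g i = g b + \sum_i lam 0 i * g i.
Proof.
rewrite [in RHS](bigD1 b)//= lamb mulN1r addrA subrr add0r big_mkcond [RHS]big_mkcond.
apply: eq_bigr => i _; have [->|ib] := eqVneq i b; first by rewrite lamb ltr0N1.
have := lam_ge0 ib; rewrite le_eqVlt => /predU1P[<-|->//].
by rewrite ltxx mul0r.
Qed.

Lemma sum_lambda_pos1 : \sum_(i | 0 < lam 0 i) lam 0 i = 1.
Proof.
have := sum_lambda_pos (fun=> 1); under eq_bigr do rewrite mulr1.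
move=> ->; under eq_bigr do rewrite mulr1.
by case: Clam => -[_ ->] _ _ _; rewrite addr0.
Qed.

Lemma lambda_AGE_coneP c : lambda_AGE_cone X alpha lam c <->
  (forall i, i != b -> 0 <= c 0 i) /\
  - c 0 b * expR (fine (sigma lam)) <=
    \prod_(i < m | 0 < lam 0 i) (c 0 i / lam 0 i) `^ lam 0 i.
Proof.
split=> [[b' [/lam_neg -> []]]//|[c0 cP]]; exists b; split => //.
by rewrite lamb ltrN10.
Qed.

(** The positive entries of lam are weights with sum 1, so AM-GM applies to (c_i / lam_i)
    exp(alpha_i^T x). The exponentials contribute exp((alpha_b + A lam)^T x), and (A lam)^T x >= -
    sigma. *)
Lemma lambda_AGE_cone_sub_AGE : X !=set0 -> lambda_AGE_cone X alpha lam `<=` AGE_cone X alpha b.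
Proof.
move=> X0 c /lambda_AGE_coneP[c0 cP]; split => // x Xx.
have [cb|cb] := leP 0 (c 0 b).
  apply: sumr_ge0 => i _; rewrite mulr_ge0 ?expR_ge0//.
  by have [->//|/c0] := eqVneq i b.
pose u i := c 0 i / lam 0 i * expR (dotp (alpha i) x).
have lc0 i : 0 < lam 0 i -> 0 <= c 0 i / lam 0 i.
  by move=> li; rewrite divr_ge0 ?c0 ?lam_neqb// ltW.
have := @weighted_AMGM R _ (fun i => 0 < lam 0 i) (lam 0) u (fun i li => li) _ sum_lambda_pos1.
move=> /(_ (fun i li => mulr_ge0 (lc0 i li) (expR_ge0 _))).
have -> : \prod_(i | 0 < lam 0 i) u i `^ lam 0 i =
    \prod_(i | 0 < lam 0 i) (c 0 i / lam 0 i) `^ lam 0 i *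
    expR (dotp (alpha b) x + dotp (Amul alpha lam) x).
  rewrite dotp_Amul -sum_lambda_pos expR_sum -big_split; apply: eq_bigr => i li /=.
  by rewrite /u powRM ?lc0 ?expR_ge0// -expRM (mulrC (lam 0 i)).
have -> : \sum_(i | 0 < lam 0 i) lam 0 i * u i =
    \sum_(i | 0 < lam 0 i) c 0 i * expR (dotp (alpha i) x).
  apply: eq_bigr => i li; rewrite /u mulrA; congr (_ * _).
  by rewrite mulrC divfK// gt_eqF.
move=> amgm; rewrite /signomial (bigD1 b)//=.
have : \sum_(i | 0 < lam 0 i) c 0 i * expR (dotp (alpha i) x) <=
    \sum_(i | i != b) c 0 i * expR (dotp (alpha i) x).
  rewrite big_mkcond [leRHS]big_mkcond; apply: ler_sum => i _.
  case: ifPn => [/lam_neqb ->//|_]; case: ifPn => // ib.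
  by rewrite mulr_ge0 ?expR_ge0 ?c0.
suff : - c 0 b * expR (dotp (alpha b) x) <=
    \prod_(i | 0 < lam 0 i) (c 0 i / lam 0 i) `^ lam 0 i *
    expR (dotp (alpha b) x + dotp (Amul alpha lam) x) by lra.
apply: le_trans (ler_wpM2r (expR_ge0 _) cP).
rewrite -mulrA -expRD; apply: ler_wpM2l; first by rewrite oppr_ge0 ltW.
rewrite ler_expR.
have [_ _ soo _] := Clam.
have : (sigma lam <= (fine (sigma lam))%:E)%E by rewrite sigmaX_fineK.
by move/sigmaX_le/(_ _ Xx); rewrite dotpNl; lra.
Qed.

Lemma orthant_sub_lambda_AGE : @orthant R m `<=` lambda_AGE_cone X alpha lam.
Proof.
move=> c c0; apply/lambda_AGE_coneP; split=> [i _|]; first exact: c0.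
rewrite (@le_trans _ _ 0)// ?mulNr ?oppr_le0 ?mulr_ge0 ?expR_ge0 ?c0//.
by apply: prodr_ge0 => i _; exact: powR_ge0.
Qed.

(** The product has degree 1 in c because its exponents add up to 1; a = 0 is treated apart. *)
Lemma lambda_AGE_scale a c : 0 <= a ->
  lambda_AGE_cone X alpha lam c -> lambda_AGE_cone X alpha lam (a *: c).
Proof.
rewrite le_eqVlt => /predU1P[<- _|a0 /lambda_AGE_coneP[c0 cP]].
  by rewrite scale0r; apply: orthant_sub_lambda_AGE => i; rewrite mxE.
apply/lambda_AGE_coneP; split=> [i ib|]; first by rewrite mxE mulr_ge0 ?c0// ltW.
have -> : \prod_(i | 0 < lam 0 i) ((a *: c) 0 i / lam 0 i) `^ lam 0 i =
    a * \prod_(i | 0 < lam 0 i) (c 0 i / lam 0 i) `^ lam 0 i.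
  have aE : a = \prod_(i | 0 < lam 0 i) a `^ lam 0 i.
    under eq_bigr do rewrite /powR gt_eqF//.
    by rewrite -expR_sum -big_distrl /= sum_lambda_pos1 mul1r lnK.
  rewrite [X in _ = X * _]aE -big_split; apply: eq_bigr => i li /=.
  by rewrite mxE -mulrA (powRM (x := a)) ?(ltW a0)// divr_ge0 ?c0 ?lam_neqb// ltW.
by rewrite mxE -mulrN -mulrA ler_pM2l.
Qed.

Lemma lambda_AGE_dual (v y : 'rV[R]_m) : (forall i, v 0 i = expR (y 0 i)) ->
  (forall c, lambda_AGE_cone X alpha lam c -> 0 <= dotp v c) ->
  0 <= dotp y lam + fine (sigma lam).
Proof.
move=> vE vC; set s := fine _.
(* This c attains equality in the defining inequality of the cone, and v . c = 1 - exp(- s - y .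
   lam), whose sign gives the claim. *)
pose c : 'rV[R]_m := \row_i if i == b then - expR (- s - (dotp y lam + y 0 b)) else lam 0 i / v 0 i.
have v0 i : 0 < v 0 i by rewrite vE expR_gt0.
have cC : lambda_AGE_cone X alpha lam c.
  apply/lambda_AGE_coneP; split=> [i ib|].
    by rewrite mxE (negPf ib) divr_ge0 ?lam_ge0// ltW.
  rewrite mxE eqxx opprK -/s -expRD addrAC addNr add0r.
  have -> : - (dotp y lam + y 0 b) = \sum_(i | 0 < lam 0 i) lam 0 i * (- y 0 i).
    rewrite sum_lambda_pos; under [in RHS]eq_bigr do rewrite mulrN mulrC.
    by rewrite sumrN opprD addrC.
  rewrite expR_sum le_eqVlt; apply/predU1P; left; apply: eq_bigr => i li.
  rewrite mxE (negPf (lam_neqb li)) mulrAC divff ?gt_eqF// mul1r vE -expRN.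
  by rewrite -expRM mulrC.
have := vC _ cC; rewrite /dotp (bigD1 b)//= mxE eqxx vE mulrN -expRD.
have -> : \sum_(i | i != b) v 0 i * c 0 i = 1.
  rewrite -sum_lambda_pos1 -[LHS]add0r.
  have := sum_lambda_pos (fun=> 1); under eq_bigr do rewrite mulr1.
  move=> ->; rewrite [in RHS](bigD1 b)//= lamb mulr1 addrA subrr; congr (_ + _).
  by apply: eq_bigr => i ib; rewrite mxE (negPf ib) mulr1 mulrC divfK// gt_eqF.
rewrite addrC subr_ge0 -expR0 ler_expR -/(dotp y lam); lra.
Qed.

End Witnessed.

Lemma SAGE_dual (v c : 'rV[R]_m) :
  (0 < m)%N -> X !=set0 -> convex_setR X -> exp_lin_indep X alpha ->
  (forall i, 0 <= v 0 i) ->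
  (forall lam d, Lambda_star X alpha lam -> lambda_AGE_cone X alpha lam d -> 0 <= dotp v d) ->
  SAGE c -> 0 <= dotp v c.
Proof.
move=> m0 X0 Xcvx Xind v0 vL Sc; rewrite leNgt; apply/negP => vc.
have [x0 Xx0] := X0.
set u := exp_row x0; set r := dotp u c.
have r0 : 0 <= r := SAGE_signomial_ge0 Sc Xx0.
have r1 : 0 < r + 1 by rewrite ltr_wpDl.
(* The perturbation makes v positive, so that logarithms exist, and keeps the pairing with c
   negative: it becomes v . c + e r = - e. *)
pose e := - dotp v c / (r + 1).
have e0 : 0 < e by rewrite divr_gt0 ?oppr_gt0.
have er : e * (r + 1) = - dotp v c by rewrite divfK// gt_eqF.
pose v' := v + e *: u.
have v'0 i : 0 < v' 0 i by rewrite !mxE ltr_wpDl// mulr_gt0 ?expR_gt0.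
have v'c : dotp v' c < 0 by rewrite dotpDl dotpZl -/r; lra.
pose y : 'rV[R]_m := \row_i ln (v' 0 i).
have v'E i : v' 0 i = expR (y 0 i) by rewrite [in RHS]mxE lnK// posrE.
have yE : forall z, epis z -> 0 <= dotp (pack (y, 1)) z.
  apply: epi_sum_dual => // lam Llam; have [[b [Clam lamb]] _] := Llam.
  apply: (lambda_AGE_dual Clam lamb v'E) => d Cd.
  rewrite dotpDl addr_ge0 ?(vL lam)// dotpZl mulr_ge0 ?(ltW e0)// -signomialE.
  by have [_] := lambda_AGE_cone_sub_AGE Clam lamb X0 Cd; apply.
move: v'c; rewrite ltNge => /negP; apply.
have [f [Ef ->]] := Sc; rewrite dotp_sumr; apply: sumr_ge0 => b _.
have yEb z : epi b z -> 0 <= dotp (pack (y, 1)) z by move=> /epi_sigma_sub_sum; exact: yE.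
have := AGE_dual X0 Xcvx yEb (Ef b).
by rewrite dotpC; under [X in 0 <= X -> _]eq_bigr do rewrite -v'E.
Qed.

End AGE.

(** * Convex hulls and the representation of the SAGE cone *)

Lemma sub_conv_hull (R : realType) (V : lmodType R) (S : set V) : S `<=` conv_hull S.
Proof.
move=> x Sx; exists 1%N, (fun=> 1), (fun=> x); split => //.
  by rewrite big_ord1.
by rewrite big_ord1 scale1r.
Qed.

Lemma conv_hull_convex (R : realType) n (S : set 'rV[R]_n) : convex_setR (conv_hull S).
Proof.
move=> x y t [k [w [p [w0 w1 Sp ->]]]] [k' [w' [p' [w'0 w'1 Sp' ->]]]] /andP[t0 t1].
have splitl i : fintype.split (lshift k' i) = inl i :> 'I_k + 'I_k' := unsplitK (inl i).
have splitr i : fintype.split (rshift k i) = inr i :> 'I_k + 'I_k' := unsplitK (inr i).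
exists (k + k')%N,
  (fun j => match fintype.split j with inl i => t * w i | inr i => (1 - t) * w' i end),
  (fun j => match fintype.split j with inl i => p i | inr i => p' i end).
split.
- by move=> j; case: fintype.split => i; rewrite mulr_ge0// subr_ge0.
- rewrite big_split_ord /=; under eq_bigr do rewrite splitl.
  under [X in _ + X]eq_bigr do rewrite splitr.
  by rewrite -!big_distrr /= w1 w'1 !mulr1 addrC subrK.
- by move=> j; case: fintype.split.
- rewrite big_split_ord /= !scaler_sumr; congr (_ + _).
    by apply: eq_bigr => i _; rewrite splitl scalerA.
  by apply: eq_bigr => i _; rewrite splitr scalerA.
Qed.

Theorem theorem5p5 (R : realType) (n m : nat) (X : set 'rV[R]_n)
    (alpha : 'I_m -> 'rV[R]_n) :
  (0 < m)%N ->
  X !=set0 -> closed X -> convex_setR X ->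
  exp_lin_indep X alpha ->
  (Lambda X alpha = set0 -> SAGE_cone X alpha = @orthant R m) /\
  (Lambda X alpha !=set0 ->
     SAGE_cone X alpha =
     closure (conv_hull (\bigcup_(lam in Lambda_star X alpha) lambda_AGE_cone X alpha lam))).
Proof.
move=> m0 X0 _ Xcvx Xind; split=> [L0|L0].
  apply/seteqP; split=> [c Sc i|]; last first.
    by move=> c /(orthant_sub_AGE X alpha (Ordinal m0))/AGE_cone_sub_SAGE.
  (* Without circuits the condition on reduced ones is vacuous, so a standard basis vector serves as
     v and reads off one coefficient of c. *)
  rewrite -dotp_delta dotpC; apply: (SAGE_dual m0 X0 Xcvx Xind _ _ Sc).
    by move=> j; rewrite mxE; case: (_ && _).
  by move=> lam d [] /[!L0].
set U := \bigcup_(_ in _) _.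
have subU lam : Lambda_star X alpha lam -> lambda_AGE_cone X alpha lam `<=` U.
  by move=> Llam c Cc; exists lam.
apply/seteqP; split=> [c Sc|]; last first.
  move=> c; rewrite [SAGE_cone _ _](closure_id _).1; last exact: SAGE_cone_closed.
  apply: closureS => _ [k [w [p [w0 _ Up ->]]]].
  apply: convex_cone_sum => // [|j]; first exact: SAGE_cone_convex_cone.
  have [lam [[b [Clam lamb]] _] Cp] := Up j.
  exact: AGE_cone_sub_SAGE (lambda_AGE_cone_sub_AGE Clam lamb X0 Cp).
apply: contrapT => Wc.
(* One reduced circuit already puts the whole orthant into the union; this gives the hull the point
   0 and later forces v to be nonnegative. *)
have [mu Lmu] := Lambda_star_neq0 X0 Xind m0 L0.
have orthU : @orthant R m `<=` U.
  move=> d d0; apply: (subU mu Lmu); have [[b [Cmu mub]] _] := Lmu.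
  exact: orthant_sub_lambda_AGE Cmu mub _ d0.
have W0 : conv_hull U 0 by apply/sub_conv_hull/orthU => i; rewrite mxE.
have [v [vn0 vW]] := separation (ex_intro _ _ W0) (@conv_hull_convex _ _ _) Wc.
have vc : dotp v c < 0.
  have := vW _ W0; rewrite dotp0r -lerBrDr sub0r => /le_lt_trans; apply.
  rewrite oppr_lt0 lt_neqAle dotpxx_ge0 andbT eq_sym.
  by apply: contra_neq vn0; exact: dotpxx_eq0.
(* Each witnessed cone is stable under nonnegative scaling, so the lower bound given by separation
   improves to 0. *)
have vU lam d : Lambda_star X alpha lam -> lambda_AGE_cone X alpha lam d -> 0 <= dotp v d.
  move=> Llam Cd; apply: (@ge0_of_scaled_bound _ (dotp v c + dotp v v)) => a a0.
  rewrite -dotpZr; apply/vW/sub_conv_hull/(subU lam Llam).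
  by have [[b [Clam lamb]] _] := Llam; exact: lambda_AGE_scale Clam lamb _ _ a0 Cd.
move: vc; rewrite ltNge => /negP; apply.
apply: (SAGE_dual m0 X0 Xcvx Xind _ vU Sc) => i.
rewrite -dotp_delta; apply: (vU mu) => //; have [[b [Cmu mub]] _] := Lmu.
apply: (orthant_sub_lambda_AGE Cmu mub) => j.
by rewrite mxE; case: (_ && _).
Qed.
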